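(* Let $B$ be a Polish metric space and let $\mathcal{X}=(X,d_X,\pi_X,\mu_X)$ and $\mathcal{Y}=(Y,d_Y,\pi_Y,\mu_Y)$ be bounded $mm$-fields over $B$. Let $U_X$ and $U_Y$ be the sets of uniformly distributed sequences in $(X,d_X,\mu_X)$ and $(Y,d_Y,\mu_Y)$, respectively. Then $$d_{GW,\infty}(\mathcal{X},\mathcal{Y})=\inf_{(x_n)\in U_X,\ (y_n)\in U_Y}\max\Big\{\frac12\sup_{i,j}|d_X(x_i,x_j)-d_Y(y_i,y_j)|,\ \sup_i d_B(\pi_X(x_i),\pi_Y(y_i))\Big\}.$$ Furthermore, there are sequences $(x_n)\in U_X$ and $(y_n)\in U_Y$ that realize the infimum on the right-hand side.
   Context: A Polish metric space is a complete separable metric space. An $mm$-field over a Polish metric space $(B,d_B)$ is a quadruple $\mathcal{X}=(X,d_X,\pi_X,\mu_X)$, where $(X,d_X)$ is a Polish metric space, $\pi_X\colon X\to B$ is 1-Lipschitz and $\mu_X$ is a Borel probability measure on $X$. It is bounded if $(X,d_X)$ has finite diameter. $C(\mu_X,\mu_Y)$ is the set of couplings, i.e. Borel probability measures on $X\times Y$ with marginals $\mu_X$ and $\mu_Y$. Put $m_{X,Y}(x,y,x',y')=|d_X(x,x')-d_Y(y,y')|$ and $d_{X,Y}(x,y)=d_B(\pi_X(x),\pi_Y(y))$. Then $$d_{GW,\infty}(\mathcal{X},\mathcal{Y}):=\inf_{\mu\in C(\mu_X,\mu_Y)}\max\Big\{\frac12\sup_{\mathrm{supp}(\mu\otimes\mu)}m_{X,Y},\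 \sup_{\mathrm{supp}\,\mu}d_{X,Y}\Big\}.$$ A sequence $(x_n)_{n\ge1}$ in $(X,d_X,\mu_X)$ is uniformly distributed if the empirical measures $\frac1n\sum_{i=1}^n\delta_{x_i}$ converge weakly to $\mu_X$ as $n\to\infty$. *)

(* Defs.v *)
From HB Require Import structures.
From mathcomp Require Import all_boot all_order all_algebra.
From mathcomp Require Import all_classical all_reals all_analysis.
Set Implicit Arguments.
Unset Strict Implicit.
Unset Printing Implicit Defensive.
Import Order.TTheory GRing.Theory Num.Theory.
Import numFieldNormedType.Exports.

Local Open Scope classical_set_scope.
Local Open Scope ring_scope.

HB.mixin Record isSeparable T & Topological T := {
  separable_subproof : exists2 D : set T, countable D & dense D
}.

(* The base point is required by MathComp-Analysis to equip a type with a
   sigma-algebra; it only excludes the empty space, which carries no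
   probability measure and is the target of no function from a nonempty space. *)
#[short(type="polishMetricType")]
HB.structure Definition PolishMetric (R : realType) :=
  {T of Pointed T & Metric R T & Complete T & isSeparable T}.

Notation borel T := (g_sigma_algebraType (@open T)).

Record mmField (R : realType) (B : polishMetricType R) := MMField {
  mm_carrier :> polishMetricType R;
  mm_proj : mm_carrier -> B;
  mm_proj_lipschitz :
    forall x y, mdist (mm_proj x) (mm_proj y) <= mdist x y;
  mm_law : probability (borel mm_carrier) R }.

Section definitions.
Context {R : realType}.
Local Open Scope ereal_scope.

Definition diameter (T : metricType R) : \bar R :=
  ereal_sup [set (mdist p.1 p.2)%:E | p in [set: T * T]].

(* Stated for set functions so that it applies both to a measure on borel (X * Y)
   and to the product of two such measures: the latter lives on the product
   sigma-algebra, which contains all open sets when the factors are separable. *)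
Definition measure_support (T : topologicalType) (mu : set T -> \bar R) : set T :=
  [set x | forall U, open_nbhs x U -> 0 < mu U].

Definition weakly_converges (T : ptopologicalType)
    (mu_ : {measure set (borel T) -> \bar R}^nat)
    (mu : {measure set (borel T) -> \bar R}) :=
  forall f : T -> R, continuous f -> bounded_fun f ->
    (\int[mu_ n]_x f x)%R @[n --> \oo] --> (\int[mu]_x f x)%R.

(* Sequences are indexed from 0: the n-th empirical measure averages the Dirac
   masses at x 0, ..., x (n - 1); it is the zero measure for n = 0. *)
Definition empirical (T : ptopologicalType) (x : nat -> T) (n : nat) :
    {measure set (borel T) -> \bar R} :=
  mscale (n%:R^-1)%:nng%R (msum (fun i => \d_(x i : borel T)) n).

Definition uniformly_distributed (B : polishMetricType R) (X : mmField B) :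
    set (nat -> X) :=
  [set x | weakly_converges (empirical x) (mm_law X)].

Section pair.
Context {B : polishMetricType R} (X Y : mmField B).

Definition couplings : set (probability (borel (X * Y)%type) R) :=
  [set mu | (forall A : set (borel X), measurable A ->
               pushforward mu fst A = mm_law X A) /\
            (forall A : set (borel Y), measurable A ->
               pushforward mu snd A = mm_law Y A)].

Definition distortion (p q : X * Y) : R :=
  `|mdist p.1 q.1 - mdist p.2 q.2|%R.

Definition fiber_dist (p : X * Y) : R :=
  mdist (mm_proj p.1) (mm_proj p.2).

Definition coupling_cost (mu : probability (borel (X * Y)%type) R) : \bar R :=
  Order.max
    ((2^-1)%:E * ereal_sup [set (distortion pq.1 pq.2)%:E
       | pq in @measure_support ((X * Y) * (X * Y))%type (mu \x mu)])
    (ereal_sup [set (fiber_dist p)%:E | p in @measure_support (X * Y)%type mu]).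

Definition dGWoo : \bar R := ereal_inf [set coupling_cost mu | mu in couplings].

Definition sequence_cost (x : nat -> X) (y : nat -> Y) : \bar R :=
  Order.max
    ((2^-1)%:E * ereal_sup [set (distortion (x ij.1, y ij.1) (x ij.2, y ij.2))%:E
       | ij in [set: nat * nat]])
    (ereal_sup [set (fiber_dist (x i, y i))%:E | i in [set: nat]]).

End pair.
End definitions.
Arguments uniformly_distributed {R B} X _.
Arguments couplings {R B} X Y _.

(* Main.v *)
Require Import Defs.
From HB Require Import structures.
From mathcomp Require Import all_boot all_order all_algebra.
From mathcomp Require Import all_classical all_reals all_analysis.
From mathcomp Require Import measurable_realfun lra zify.
Set Implicit Arguments.
Unset Strict Implicit.
Unset Printing Implicit Defensive.
Import Order.TTheory GRing.Theory Num.Theory.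
Import numFieldNormedType.Exports.
Local Open Scope classical_set_scope.
Local Open Scope ring_scope.

(** Both sides of the identity are compared through couplings and sequences of
    pairs; each inequality turns one kind of object into the other.

    From a coupling to sequences. If m couples the laws of X and Y, choose a
    sequence of pairs (x_n, y_n) in the support of m whose empirical measures
    converge weakly to m. Its coordinates are uniformly distributed in X and
    in Y, and since the pairs and the pairs of pairs all lie in the supports of
    m and of m * m, the cost of the sequences is at most the cost of m
    (coupling_to_sequences). The sequence is built deterministically
    (typical_sequence): a countable base splits the space into a binary tree of
    cells, and the points are routed down the tree one by one, each node sending
    to its left child exactly the integer part of the share that m prescribes.
    The frequency of every cell then converges to its mass, hence the lower
    limit of the frequencies of an open set is at least its measure, which is
    weak convergence (portmanteau).

    From sequences to a coupling. Given sequences (x^k, y^k) of costs tending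
    to c, average a bounded function along each of them and take limits along an
    ultrafilter, first over the length of the average and then over k. The
    result is a finitely additive mean on X * Y whose marginals on continuous
    functions are the two given laws. Both laws are tight, so the mean
    satisfies Daniell's continuity condition (marginals_daniell_continuous) and
    is represented on open sets by a Borel probability measure, which is a
    coupling (daniell_measure, mean_coupling). An open set of positive measure
    contains pairs (x^k_i, y^k_i) for a set of indices k in the ultrafilter;
    letting the open set shrink to a point of the support, the cost of the
    coupling is at most c (sequences_to_coupling). This replaces Prokhorov's
    theorem and the lower semicontinuity of the cost.

    Taking for c the infimum over sequences, the second construction yields a
    coupling of cost at most c, and the first one turns this coupling into
    sequences of cost at most c: they realize the infimum. *)

(** * Bounded functions *)

Section bounded_functions.
Context {R : realType} {T : Type}.
Implicit Types f g : T -> R.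

Lemma bounded_funE f : bounded_fun f <-> exists M : R, forall x, `|f x| <= M.
Proof.
split => [bf|[M fM]].
  have [M [_ fM]] := bf.
  by exists (M + 1) => x; apply: fM => //; rewrite ltrDl.
exists M; split; first exact: num_real.
by move=> N /ltW MN x _; exact: le_trans MN.
Qed.

Lemma bounded_fun_cst c : bounded_fun (cst c : T -> R).
Proof. by apply/bounded_funE; exists `|c|. Qed.

Lemma bounded_funD f g : bounded_fun f -> bounded_fun g -> bounded_fun (f \+ g).
Proof.
move=> /bounded_funE[M fM] /bounded_funE[N gN]; apply/bounded_funE.
by exists (M + N) => x; rewrite (le_trans (ler_normD _ _))// lerD.
Qed.

Lemma bounded_funN f : bounded_fun f -> bounded_fun (\- f).
Proof.
move=> /bounded_funE[M fM]; apply/bounded_funE.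
by exists M => x; rewrite normrN.
Qed.

Lemma bounded_funB f g : bounded_fun f -> bounded_fun g -> bounded_fun (f \- g).
Proof. by move=> bf bg; apply: bounded_funD => //; exact: bounded_funN. Qed.

Lemma bounded_funM f g : bounded_fun f -> bounded_fun g -> bounded_fun (f \* g).
Proof.
move=> /bounded_funE[M fM] /bounded_funE[N gN]; apply/bounded_funE.
by exists (M * N) => x; rewrite normrM ler_pM.
Qed.

Lemma bounded_fun_itv f a b : (forall x, a <= f x <= b) -> bounded_fun f.
Proof.
move=> fab; apply/bounded_funE; exists (`|a| + `|b|) => x.
have /andP[af fb] := fab x; rewrite ler_norml; apply/andP; split.
  by rewrite (le_trans _ af)// lerNl (le_trans (ler_norm _))// normrN lerDl.
by rewrite (le_trans fb)// (le_trans (ler_norm _))// lerDr.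
Qed.

End bounded_functions.

Lemma bounded_fun_comp {R : realType} {S T : Type} (f : T -> R) (h : S -> T) :
  bounded_fun f -> bounded_fun (f \o h).
Proof. by move=> /bounded_funE[M fM]; apply/bounded_funE; exists M => x /=. Qed.

(** * Continuous functions and cozero sets *)

Lemma continuous_sum {R : realType} {T : topologicalType} (F : nat -> T -> R) n :
  (forall i, continuous (F i)) -> continuous (fun x => \sum_(i < n) F i x).
Proof.
move=> cF; elim: n => [|n IHn].
  have -> : (fun x => \sum_(i < 0) F i x) = cst 0.
    by apply/funext => x; rewrite big_ord0.
  by move=> x; exact: cvg_cst.
have -> : (fun x => \sum_(i < n.+1) F i x) = (fun x => \sum_(i < n) F i x) \+ F n.
  by apply/funext => x; rewrite big_ord_recr.
by move=> x; apply: cvgD; [exact: IHn|exact: cF].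
Qed.

Lemma open_cozero {R : realType} {T : topologicalType} (g : T -> R) :
  continuous g -> open [set x | 0 < g x].
Proof.
move=> cg; rewrite (_ : [set _ | _] = g @^-1` [set t | 0 < t])//.
by apply: open_comp => [x _|]; [exact: cg|exact: open_gt].
Qed.

Section plateau.
Context {R : realType} {T : topologicalType}.

(** For g nonnegative and continuous these functions increase to the indicator
    of [set x | 0 < g x], so they test the mass of a cozero set by continuous
    functions. *)
Definition plateau (g : T -> R) (n : nat) : T -> R := fun x => Num.min 1 (n%:R * g x).

Variables (g : T -> R) (cg : continuous g) (g0 : forall x, 0 <= g x).

Lemma plateau_itv n x : 0 <= plateau g n x <= 1.
Proof. by rewrite /plateau le_min ler01 mulr_ge0//= ge_min lexx. Qed.

Lemma bounded_plateau n : bounded_fun (plateau g n).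
Proof. by apply: (@bounded_fun_itv _ _ _ 0 1) => x; exact: plateau_itv. Qed.

Lemma continuous_plateau n : continuous (plateau g n).
Proof.
move=> x; apply: (@continuous_min _ _ (cst 1) (fun y => n%:R * g y)).
  exact: cvg_cst.
by apply: cvgM; [exact: cvg_cst|exact: cg].
Qed.

Lemma plateau_step n x : plateau g n x <= plateau g n.+1 x.
Proof.
rewrite /plateau le_min ge_min lexx/= ge_min; apply/orP; right.
by rewrite ler_wpM2r// ler_nat.
Qed.

Lemma plateau_homo x : {homo (plateau g)^~ x : m n / (m <= n)%N >-> m <= n}.
Proof. by apply: homo_leq (lexx) (le_trans) _ => n; exact: plateau_step. Qed.

Lemma plateau_eq0 n x : ~ 0 < g x -> plateau g n x = 0.
Proof.
move=> /negP; rewrite -leNgt /plateau => gx.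
have -> : g x = 0 by apply/le_anti; rewrite gx g0.
by rewrite mulr0 min_r.
Qed.

Lemma plateau_eventually1 x : 0 < g x -> exists n, plateau g n x = 1.
Proof.
move=> gx; exists (Num.truncn (g x)^-1).+1; apply/min_l.
by rewrite -ler_pdivrMr// div1r ltW// truncnS_gt.
Qed.

End plateau.

(** A countable base of the topology made of cozero sets, given by the
    functions that define them. *)
Definition cozero_base {R : realType} {T : topologicalType} (g : nat -> T -> R) :=
  [/\ forall i, continuous (g i), forall i x, 0 <= g i x &
      forall U x, open U -> U x ->
        exists i, 0 < g i x /\ [set y | 0 < g i y] `<=` U].

Lemma cozero_base_open {R : realType} {T : topologicalType} (g : nat -> T -> R) (U : set T) :
  cozero_base g -> open U ->
  exists h : nat -> T -> R, [/\ forall i, continuous (h i), forall i x, 0 <= h i x &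
      U = \bigcup_i [set x | 0 < h i x]].
Proof.
move=> [cg g0 gU] oU.
exists (fun i => if `[< [set y | 0 < g i y] `<=` U >] then g i else cst 0); split.
- by move=> i; case: ifP => // _ x; exact: cvg_cst.
- by move=> i x; case: ifP.
- apply/seteqP; split=> [x Ux|x [i _]] /=.
    have [i [gi giU]] := gU _ _ oU Ux; exists i => //=.
    by case: ifPn => // /asboolPn.
  by case: ifPn => [/asboolP giU|_ /=]; [exact: giU|rewrite ltxx].
Qed.

(** * Means *)

Section mean.
Context {R : realType} {T : Type}.
Implicit Types f g : T -> R.

(** An expectation that is only finitely additive. It is defined on all
    functions, and constrained on all bounded ones rather than on the continuous
    ones, because averages and their limits along ultrafilters make sense there. *)
Record is_mean (L : (T -> R) -> R) : Prop := {
  meanD : forall f g, bounded_fun f -> bounded_fun g -> L (f \+ g) = L f + L g ;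
  mean_ge0 : forall f, bounded_fun f -> (forall x, 0 <= f x) -> 0 <= L f ;
  mean_cst : forall c, L (cst c) = c }.

Variables (L : (T -> R) -> R) (mL : is_mean L).

Lemma meanB f g : bounded_fun f -> bounded_fun g -> L (f \- g) = L f - L g.
Proof.
move=> bf bg; have := meanD mL (bounded_funB bf bg) bg.
have -> : (f \- g) \+ g = f by apply/funext => x /=; rewrite subrK.
by move=> ->; rewrite addrK.
Qed.

Lemma le_mean f g : bounded_fun f -> bounded_fun g ->
  (forall x, f x <= g x) -> L f <= L g.
Proof.
move=> bf bg fg; rewrite -subr_ge0 -meanB//.
by apply: (mean_ge0 mL); [exact: bounded_funB|move=> x /=; rewrite subr_ge0].
Qed.

Lemma mean_sum (F : nat -> T -> R) n : (forall i, bounded_fun (F i)) ->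
  bounded_fun (fun x => \sum_(i < n) F i x) /\
  L (fun x => \sum_(i < n) F i x) = \sum_(i < n) L (F i).
Proof.
move=> bF; elim: n => [|n [bn IHn]].
  have -> : (fun x => \sum_(i < 0) F i x) = cst 0.
    by apply/funext => x; rewrite big_ord0.
  by rewrite big_ord0 (mean_cst mL); split => //; exact: bounded_fun_cst.
have -> : (fun x => \sum_(i < n.+1) F i x) = (fun x => \sum_(i < n) F i x) \+ F n.
  by apply/funext => x; rewrite big_ord_recr.
by rewrite big_ord_recr/= (meanD mL)// IHn; split => //; exact: bounded_funD.
Qed.

End mean.

(** * The Daniell outer measure of a mean *)

Section daniell_outer_measure.
Context {R : realType} {T : topologicalType}.
Variables (L : (T -> R) -> R) (mL : is_mean L).
Implicit Types (f g : T -> R) (F : nat -> T -> R) (M : set T).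

(** A sequence of continuous functions increasing to a limit that is at least 1
    on M. Increasing sequences are preferred to series of nonnegative functions:
    the product of two of them is again one, and the n-th partial sums of the
    n-th terms dominate countably many of them at once. *)
Record upper_approx F M : Prop := {
  ua_continuous : forall n, continuous (F n) ;
  ua_bounded : forall n, bounded_fun (F n) ;
  ua_ge0 : forall n x, 0 <= F n x ;
  ua_step : forall n x, F n x <= F n.+1 x ;
  ua_cover : forall x, M x -> forall c, c < 1 -> exists n, c < F n x }.

Definition daniell_outer M : \bar R :=
  ereal_inf [set r%:E | r in [set r | exists2 F, upper_approx F M &
                                        forall n, L (F n) <= r]].

Lemma ua_homo F M : upper_approx F M ->
  forall x, {homo F^~ x : m n / (m <= n)%N >-> m <= n}.
Proof. by move=> FM x; apply: homo_leq lexx le_trans _ => n; exact: (ua_step FM). Qed.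

Lemma daniell_outer_le F M r : upper_approx F M -> (forall n, L (F n) <= r) ->
  (daniell_outer M <= r%:E)%E.
Proof. by move=> FM Fr; apply: ereal_inf_lbound; exists r => //; exists F. Qed.

Lemma daniell_outer_ge0 M : (0 <= daniell_outer M)%E.
Proof.
apply/le_ereal_inf_tmp => _ [r [F FM Fr] <-]; rewrite lee_fin.
rewrite (le_trans _ (Fr 0%N))// (mean_ge0 mL)//; first exact: (ua_bounded FM).
exact: (ua_ge0 FM).
Qed.

Lemma upper_approx_cst1 M : upper_approx (fun=> cst 1) M.
Proof.
split => //; first by move=> n x; exact: cvg_cst.
- by move=> n; exact: bounded_fun_cst.
- by move=> x Mx c c1; exists 0%N.
Qed.

Lemma daniell_outer_le1 M : (daniell_outer M <= 1)%E.
Proof.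
by apply: (daniell_outer_le (upper_approx_cst1 M)) => n; rewrite (mean_cst mL).
Qed.

Lemma daniell_outer_fin_num M : daniell_outer M \is a fin_num.
Proof.
rewrite ge0_fin_numE ?daniell_outer_ge0//.
by rewrite (le_lt_trans (daniell_outer_le1 _))// ltry.
Qed.

Lemma daniell_outer_approx M (e : R) : 0 < e -> exists F r,
  [/\ upper_approx F M, forall n, L (F n) <= r & (r%:E <= daniell_outer M + e%:E)%E].
Proof.
move=> e0; have [_ [r [F FM Fr] <-] /ltW re] :=
  lb_ereal_inf_adherent e0 (daniell_outer_fin_num M).
by exists F, r.
Qed.

Lemma daniell_outer0 : daniell_outer set0 = 0%E.
Proof.
apply/eqP; rewrite eq_le daniell_outer_ge0 andbT.
apply: (@daniell_outer_le (fun=> cst 0)) => [|n]; last by rewrite (mean_cst mL).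
split => //; first by move=> n x; exact: cvg_cst.
by move=> n; exact: bounded_fun_cst.
Qed.

Lemma le_daniell_outer : {homo daniell_outer : A B / A `<=` B >-> (A <= B)%E}.
Proof.
move=> A B AB; apply: le_ereal_inf_tmp => _ [r [F FB Fr] <-].
apply: (daniell_outer_le _ Fr); split; [exact: ua_continuous FB|
  exact: ua_bounded FB|exact: ua_ge0 FB|exact: ua_step FB|].
by move=> x /AB; exact: (ua_cover FB).
Qed.

(** If F_i approximates A_i, the diagonal sequence of the sums of F_i n over
    i < n approximates the union. *)
Lemma daniell_outer_sigma_subadditive : sigma_subadditive daniell_outer.
Proof.
move=> A; have [<-|sNoo] := eqVneq +oo%E (\sum_(i <oo) daniell_outer (A i))%E.
  exact: leey.
apply/lee_addgt0Pr => e e0.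
have /choice[G PG] : forall i, exists Fr : (nat -> T -> R) * R,
   [/\ upper_approx Fr.1 (A i), forall n, L (Fr.1 n) <= Fr.2 &
     (Fr.2%:E <= daniell_outer (A i) + (e / (2 ^ i.+1)%:R)%:E)%E].
  move=> i; have [|F [r Fr]] := @daniell_outer_approx (A i) (e / (2 ^ i.+1)%:R).
    by rewrite divr_gt0// ltr0n expn_gt0.
  by exists (F, r).
have s0 : (0 <= \sum_(i <oo) daniell_outer (A i))%E.
  by apply: nneseries_ge0 => i _ _; exact: daniell_outer_ge0.
have sfin : (\sum_(i <oo) daniell_outer (A i))%E \is a fin_num.
  by rewrite ge0_fin_numE// ltey eq_sym.
rewrite -(fineK sfin) -EFinD.
apply: (@daniell_outer_le (fun n x => \sum_(i < n) (G i).1 n x)).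
  split.
  - by move=> n; apply: (@continuous_sum _ _ (fun i => (G i).1 n)) => i;
      have [FA _ _] := PG i; exact: ua_continuous FA _.
  - move=> n; apply: (@mean_sum _ _ _ mL (fun i => (G i).1 n) n _).1 => i.
    by have [FA _ _] := PG i; exact: ua_bounded FA _.
  - by move=> n x; apply: sumr_ge0 => i _; have [FA _ _] := PG i; exact: ua_ge0 FA _ _.
  - move=> n x; rewrite big_ord_recr/= -[leLHS]addr0; apply: lerD.
      by apply: ler_sum => i _; have [FA _ _] := PG i; exact: ua_step FA _ _.
    by have [FA _ _] := PG n; exact: ua_ge0 FA _ _.
  - move=> x [i _ Aix] c c1; have [FA _ _] := PG i.
    have [n cn] := ua_cover FA Aix c1; exists (maxn n i.+1).
    have im : (i < maxn n i.+1)%N by rewrite leq_max ltnS leqnn orbT.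
    rewrite (lt_le_trans cn)// (bigD1 (Ordinal im))//= -[leLHS]addr0; apply: lerD.
      by apply: ua_homo FA _ _ _ _; exact: leq_maxl.
    by apply: sumr_ge0 => j _; have [FjA _ _] := PG j; exact: ua_ge0 FjA _ _.
move=> n; rewrite (@mean_sum _ _ _ mL (fun i => (G i).1 n) n _).2; last first.
  by move=> i; have [FA _ _] := PG i; exact: ua_bounded FA _.
rewrite -lee_fin EFinD fineK//.
apply: (le_trans _ (epsilon_trick (fun=> true) _ _));
  [|move=> i; exact: daniell_outer_ge0|exact: ltW].
rewrite -sumEFin.
apply: (@le_trans _ _ (\sum_(i < n) (daniell_outer (A i) + (e / (2 ^ i.+1)%:R)%:E))%E).
  apply: lee_sum => i _; have [_ Fr rA] := PG i.
  by rewrite (le_trans _ rA)// lee_fin Fr.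
rewrite -(big_mkord xpredT (fun i => daniell_outer (A i) + (e / (2 ^ i.+1)%:R)%:E)%E).
apply: nneseries_lim_ge => i _ _; rewrite adde_ge0 ?daniell_outer_ge0// lee_fin.
by rewrite divr_ge0// ltW.
Qed.

HB.instance Definition _ := @isOuterMeasure.Build R T daniell_outer
  daniell_outer0 daniell_outer_ge0 le_daniell_outer daniell_outer_sigma_subadditive.

Definition daniell_outer_measure : {outer_measure set T -> \bar R} := daniell_outer.

Section cozero.
Variables (g : T -> R) (cg : continuous g) (g0 : forall x, 0 <= g x).

Lemma upper_approx_plateau : upper_approx (plateau g) [set x | 0 < g x].
Proof.
split; [exact: continuous_plateau|exact: bounded_plateau| |exact: plateau_step|].
  by move=> n x; have /andP[] := plateau_itv g0 n x.
by move=> x /plateau_eventually1[n gn] c c1; exists n; rewrite gn.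
Qed.

(** Let F approximate X, let u n be the plateau functions of g and let s be the
    supremum of L (F n * u n). The products F n * u n approximate the part of X
    in the cozero set. For an index K with L (F K * u K) > s - e, the functions
    F n * (1 - u K) approximate the part of X outside it, and their means are at
    most r - (s - e) when those of F are at most r. The two bounds add up to
    r + e. *)
Lemma cozero_caratheodory : daniell_outer.-caratheodory [set x | 0 < g x].
Proof.
apply: (@le_caratheodory_measurable _ _ daniell_outer_measure) => X.
rewrite /=; apply: le_ereal_inf_tmp => _ [r [F FX Fr] <-].
set G := [set x | 0 < g x].
have pb n : bounded_fun (plateau g n) by exact: bounded_plateau.
have Fb := ua_bounded FX.
have F0 := ua_ge0 FX.
pose s := sup (range (fun n => L (F n \* plateau g n))).
have hs : has_sup (range (fun n => L (F n \* plateau g n))).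
  split; first by exists (L (F 0%N \* plateau g 0)); exists 0%N.
  exists r => _ [n _ <-]; apply: le_trans (Fr n); apply: (le_mean mL) => //.
    exact: bounded_funM.
  by move=> x /=; rewrite ler_piMr//; have /andP[] := plateau_itv g0 n x.
have XG : (daniell_outer (X `&` G) <= s%:E)%E.
  apply: (@daniell_outer_le (fun n => F n \* plateau g n)) => [|n]; last first.
    by apply: ub_le_sup; [exact: hs.2|exists n].
  split.
  - by move=> n x; apply: cvgM; [exact: (ua_continuous FX)|exact: continuous_plateau].
  - by move=> n; exact: bounded_funM.
  - by move=> n x; rewrite mulr_ge0//; have /andP[] := plateau_itv g0 n x.
  - move=> n x; rewrite ler_pM//; first by have /andP[] := plateau_itv g0 n x.
      exact: (ua_step FX).
    exact: plateau_step.
  - move=> x [Xx Gx] c c1; have [m gm] := plateau_eventually1 Gx.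
    have [n cn] := ua_cover FX Xx c1; exists (maxn m n); rewrite /=.
    have -> : plateau g (maxn m n) x = 1.
      apply/le_anti; rewrite -{2}gm (plateau_homo g0 _ (leq_maxl _ _)) andbT.
      by have /andP[] := plateau_itv g0 (maxn m n) x.
    by rewrite mulr1 (lt_le_trans cn)// (ua_homo FX)// leq_maxr.
apply/lee_addgt0Pr => e e0.
(* K is fixed first: the outer part is approximated with a single plateau. *)
have [_ [K _ <-] sK] := sup_adherent e0 hs.
have XCG : (daniell_outer (X `&` ~` G) <= (r - (s - e))%:E)%E.
  apply: (@daniell_outer_le (fun n => F n \* (cst 1 \- plateau g K))) => [|n].
    split.
    - move=> n x; apply: cvgM; first exact: (ua_continuous FX).
      by apply: cvgB; [exact: cvg_cst|exact: continuous_plateau].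
    - move=> n; apply: bounded_funM => //; apply: bounded_funB => //.
      exact: bounded_fun_cst.
    - by move=> n x /=; rewrite mulr_ge0// subr_ge0; have /andP[] := plateau_itv g0 K x.
    - move=> n x /=; rewrite ler_wpM2r//; last exact: (ua_step FX).
      by rewrite subr_ge0; have /andP[] := plateau_itv g0 K x.
    - move=> x [Xx nGx] c c1; have [n cn] := ua_cover FX Xx c1; exists n => /=.
      by rewrite plateau_eq0// subr0 mulr1.
  have -> : F n \* (cst 1 \- plateau g K) = F n \- F n \* plateau g K.
    by apply/funext => x /=; rewrite mulrBr mulr1.
  rewrite (meanB mL)//; last exact: bounded_funM.
  pose m := maxn n K.
  apply: (@le_trans _ _ (L (F m \- F m \* plateau g K))).
    rewrite -(meanB mL)//; last exact: bounded_funM.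
    apply: (le_mean mL); [by apply: bounded_funB => //; exact: bounded_funM..|].
    move=> x /=; rewrite -[X in X - _ <= _]mulr1 -[X in _ <= X - _]mulr1 -!mulrBr.
    rewrite ler_wpM2r//; last by apply: (ua_homo FX); exact: leq_maxl.
    by rewrite subr_ge0; have /andP[] := plateau_itv g0 K x.
  rewrite (meanB mL)//; last exact: bounded_funM.
  rewrite lerB// ?Fr// (le_trans (ltW sK))//; apply: (le_mean mL).
  - exact: bounded_funM.
  - exact: bounded_funM.
  - move=> x /=; rewrite ler_wpM2r//; last by apply: (ua_homo FX); exact: leq_maxr.
    by have /andP[] := plateau_itv g0 K x.
apply: (le_trans (leeD XG XCG)); rewrite -!EFinD lee_fin; lra.
Qed.

End cozero.

(** Daniell's condition: no mass escapes along a sequence of functions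
    decreasing to 0. It is what a mean may lack to come from a measure. *)
Definition daniell_continuous := forall h : nat -> T -> R,
  (forall n, continuous (h n)) -> (forall n x, 0 <= h n x <= 1) ->
  (forall n x, h n.+1 x <= h n x) -> (forall x e, 0 < e -> exists n, h n x < e) ->
  forall e, 0 < e -> exists n, L (h n) < e.

(** If F approximates the whole space, then max 0 (1 - F n) decreases to 0, so
    that the means of F n get arbitrarily close to 1. *)
Lemma daniell_outer_setT : daniell_continuous -> daniell_outer setT = 1%E.
Proof.
move=> dL; apply/eqP; rewrite eq_le daniell_outer_le1/=.
apply: le_ereal_inf_tmp => _ [r [F FT Fr] <-]; rewrite lee_fin.
pose h n x : R := Num.max 0 (1 - F n x).
have h01 n x : 0 <= h n x <= 1.
  by rewrite le_max lexx/= ge_max ler01/= gerBl (ua_ge0 FT).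
apply/ler_addgt0Pr => e e0; have [||||n Lhn] := dL h _ _ _ _ _ e0 => //.
- move=> n x; apply: (@continuous_max _ _ (cst 0) (fun y => 1 - F n y)).
    exact: cvg_cst.
  by apply: cvgB; [exact: cvg_cst|exact: (ua_continuous FT)].
- move=> n x; rewrite /h ge_max le_max lexx/= le_max lerB ?orbT//.
  exact: (ua_step FT).
- move=> x d d0; have [|n dn] := @ua_cover _ _ FT x I (1 - d); first by rewrite gtrBl.
  by exists n; rewrite /h gt_max d0/= ltrBlDr -ltrBlDl.
have bh : bounded_fun (h n) by apply: (@bounded_fun_itv _ _ _ 0 1) => x.
apply: (@le_trans _ _ (L (F n \+ h n))); last first.
  by rewrite (meanD mL)//; [exact: lerD (Fr n) (ltW Lhn)|exact: ua_bounded FT _].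
rewrite -[leLHS](mean_cst mL); apply: (le_mean mL).
- exact: bounded_fun_cst.
- by apply: bounded_funD => //; exact: ua_bounded FT _.
- by move=> x /=; rewrite -lerBlDl /h le_max lexx orbT.
Qed.

End daniell_outer_measure.

(** * The Borel probability measure represented by a mean *)

(** Joins the pointed and the topological structures of a product, so that the
    results on Borel sets of pointed topological spaces apply to it. *)
HB.instance Definition _ (S T : ptopologicalType) := Pointed.on (S * T)%type.

Section daniell_measure.
Context {R : realType} {T : ptopologicalType}.
Variables (L : (T -> R) -> R) (mL : is_mean L) (dL : daniell_continuous L).
Variables (b : nat -> T -> R) (bT : cozero_base b).

Let D := daniell_outer_measure mL.

Let borel_caratheodory (A : set (borel T)) : measurable A -> D.-caratheodory A.
Proof.
suff : (<<s @open T >>) `<=` D.-cara.-measurable by exact.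
apply: smallest_sub; first exact: sigma_algebra_measurable.
move=> U /(cozero_base_open bT)[g [cg g0 ->]]; apply: bigcup_measurable => i _.
exact: cozero_caratheodory.
Qed.

Let mu (A : set (borel T)) : \bar R := D A.

Let mu0 : mu set0 = 0%E. Proof. exact: daniell_outer0. Qed.

Let mu_ge0 A : (0 <= mu A)%E. Proof. exact: daniell_outer_ge0. Qed.

Let mu_sigma_additive : semi_sigma_additive mu.
Proof.
move=> F mF tF mUF; apply: (@caratheodory_measure_sigma_additive _ _ D F) => //.
- by move=> i; exact: borel_caratheodory.
- exact: (borel_caratheodory mUF).
Qed.

HB.instance Definition _ := isMeasure.Build _ (borel T) R mu mu0 mu_ge0 mu_sigma_additive.

Let mu_setT : mu setT = 1%E. Proof. exact: daniell_outer_setT. Qed.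

HB.instance Definition _ := @Measure_isProbability.Build _ (borel T) R mu mu_setT.

(** Only the upper bound on cozero sets is stated: applied to the preimages of
    the open sets of a factor it determines the marginals, and it shows that a
    set of positive measure is seen by the mean. *)
Lemma daniell_measure : exists m : probability (borel T) R,
  forall g : T -> R, continuous g -> (forall x, 0 <= g x)%R ->
  forall r : R, (forall n, L (plateau g n) <= r)%R -> (m [set x | (0 < g x)%R] <= r%:E)%E.
Proof.
exists mu => g cg g0 r gr.
by apply: (daniell_outer_le _ gr); exact: upper_approx_plateau.
Qed.

End daniell_measure.

(** * Integration of continuous functions *)

Section borel.
Context {R : realType} {T : ptopologicalType}.

Lemma open_borel (U : set T) : open U -> measurable (U : set (borel T)).
Proof. exact: sub_gen_smallest. Qed.

Lemma continuous_borel_measurable (f : T -> R) : continuous f ->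
  measurable_fun [set: borel T] f.
Proof.
move=> cf; apply: (measurability _ (RGenOpens.measurableE R)).
move=> _ [_ [a [b ->] <-]]; rewrite setTI; apply: open_borel.
by apply: open_comp => [x _|]; [exact: cf|exact: interval_open].
Qed.

Lemma continuous_bounded_integrable (P : {measure set (borel T) -> \bar R}) (f : T -> R) :
  (P setT < +oo)%E ->
  continuous f -> bounded_fun f -> P.-integrable setT (EFin \o f).
Proof.
move=> Poo cf bf; apply: measurable_bounded_integrable => //.
exact: continuous_borel_measurable.
Qed.

Lemma probability_integrable (P : probability (borel T) R) (f : T -> R) :
  continuous f -> bounded_fun f -> P.-integrable setT (EFin \o f).
Proof.
move=> cf bf; apply: continuous_bounded_integrable => //.
by rewrite -ge0_fin_numE// fin_num_measure.
Qed.

Definition average (x : nat -> T) (n : nat) (f : T -> R) : R :=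
  n%:R^-1 * \sum_(i < n) f (x i).

Lemma average_mean x n : (0 < n)%N -> is_mean (average x n).
Proof.
move=> n0; split.
- by move=> f g _ _; rewrite /average big_split mulrDr.
- move=> f _ f0; rewrite /average mulr_ge0 ?invr_ge0//.
  by apply: sumr_ge0 => i _; exact: f0.
- move=> c; rewrite /average (eq_bigr (fun=> c))// sumr_const card_ord -[c *+ n]mulr_natl.
  rewrite mulrA mulVf ?mul1r//.
  by rewrite pnatr_eq0 -lt0n.
Qed.

Let empirical_ge0 (x : nat -> T) n (f : T -> R) : measurable_fun [set: borel T] f ->
  (forall y, 0 <= f y) ->
  (\int[empirical x n]_y (f y)%:E = (average x n f)%:E)%E.
Proof.
move=> mf f0; have mf' : measurable_fun [set: borel T] (fun y : borel T => (f y)%:E).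
  exact/measurable_EFinP.
rewrite ge0_integral_mscale//; last by move=> ? _; rewrite lee_fin.
rewrite ge0_integral_measure_sum//; last by move=> ? _; rewrite lee_fin.
rewrite /average EFinM -sumEFin; congr (_ * _)%E.
apply: eq_bigr => i _; rewrite integral_dirac//.
by rewrite diracT mul1e.
Qed.

Lemma empirical_setT_lty (x : nat -> T) n : (@empirical R T x n setT < +oo)%E.
Proof.
rewrite -[ltLHS]mul1e -integral_cst//.
by rewrite (@empirical_ge0 x n (cst 1))// ltry.
Qed.

(** The integral against a sum of Dirac masses is available for nonnegative
    functions; adding a constant reduces to that case. Both sides are 0 when n
    is 0. *)
Lemma Rintegral_empirical (x : nat -> T) n (f : T -> R) :
  continuous f -> bounded_fun f ->
  \int[empirical x n]_y f y = average x n f.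
Proof.
move=> cf bf; have /bounded_funE[M fM] := bf.
have foo := empirical_setT_lty x n.
have cc : continuous (cst M : T -> R) by move=> ?; exact: cvg_cst.
have bc : bounded_fun (cst M : T -> R) by exact: bounded_fun_cst.
have -> : average x n f = average x n (f \+ cst M) - average x n (cst M).
  by rewrite -mulrBr; congr (_ * _); rewrite -sumrB; apply: eq_bigr => i _ /=; rewrite addrK.
have M0 : 0 <= M by rewrite (le_trans _ (fM point)).
have cfM : continuous (f \+ cst M) by move=> y; apply: cvgD; [exact: cf|exact: cc].
have fM0 y : 0 <= (f \+ cst M) y.
  by have := fM y; rewrite ler_norml /= -lerBlDr sub0r => /andP[].
rewrite /Rintegral -[RHS]/(fine (_ - _)%:E) EFinB; congr fine.
rewrite -(empirical_ge0 x n (continuous_borel_measurable cfM) fM0).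
rewrite -(empirical_ge0 x n (continuous_borel_measurable cc) (fun=> M0)).
rewrite -integralB_EFin//; last 2 first.
  by apply: continuous_bounded_integrable => //; exact: bounded_funD.
  exact: continuous_bounded_integrable.
by apply: eq_integral => y _ /=; rewrite -EFinB addrK.
Qed.

Lemma weakly_convergesE (P : probability (borel T) R) (x : nat -> T) :
  weakly_converges (empirical x) P <->
  forall f : T -> R, continuous f -> bounded_fun f ->
    average x n f @[n --> \oo] --> \int[P]_y f y.
Proof.
split=> xP f cf bf; have := xP f cf bf; rewrite /weakly_converges.
  by under eq_fun do rewrite Rintegral_empirical//.
by under [in X in _ -> X]eq_fun do rewrite Rintegral_empirical//.
Qed.

End borel.

Section plateau_integral.
Context {R : realType} {X : ptopologicalType} (P : probability (borel X) R).

Lemma cvg_plateau_integral (g : X -> R) : continuous g -> (forall x, 0 <= g x) ->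
  (\int[P]_x plateau g n x)%:E @[n --> \oo] --> P [set x | 0 < g x].
Proof.
move=> cg g0.
have cp n : continuous (plateau g n) by exact: continuous_plateau.
have bp n : bounded_fun (plateau g n) by exact: bounded_plateau.
have p01 n x : 0 <= plateau g n x <= 1 by exact: plateau_itv.
have mp n : measurable_fun [set: borel X] (fun y : borel X => (plateau g n y)%:E).
  apply/measurable_EFinP; apply: continuous_borel_measurable; exact: cp.
have : (\int[P]_x (plateau g n x)%:E)%E @[n --> \oo] -->
    (\int[P]_x limn (fun n => (plateau g n x)%:E))%E.
  apply: cvg_monotone_convergence => //.
    by move=> n x _; rewrite lee_fin; have /andP[] := p01 n x.
  by move=> x _ m n mn; rewrite lee_fin; exact: plateau_homo.
have -> : (fun n => (\int[P]_x plateau g n x)%:E) =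
          (fun n => (\int[P]_x (plateau g n x)%:E)%E).
  apply/funext => n; rewrite fineK//; apply: integrable_fin_num => //.
  exact: probability_integrable.
suff -> : (\int[P]_x limn (fun n => (plateau g n x)%:E) = P [set x | (0 < g x)%R])%E by [].
have mG : measurable ([set x | 0 < g x] : set (borel X)).
  by apply: open_borel; exact: open_cozero.
rewrite -[X in _ = P X]setIT -integral_indic//; apply: eq_integral => x _; rewrite indicE.
have [/set_mem gx|/negP gx] := boolP (x \in _).
  have [m gm] := plateau_eventually1 gx; apply/cvg_lim => //.
  apply: cvg_near_cst; exists m => // n /= mn; congr EFin; apply/le_anti.
  rewrite -{2}gm (plateau_homo g0 _ mn) andbT.
  by have /andP[] := p01 n x.
apply/cvg_lim => //; apply: cvg_near_cst; apply: nearW => n.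
rewrite plateau_eq0// => gx'; apply: gx; exact: mem_set.
Qed.

End plateau_integral.

Section plateau_integral_bounds.
Context {R : realType} {X : ptopologicalType} (P : probability (borel X) R).
Variables (g : X -> R) (cg : continuous g) (g0 : forall x, 0 <= g x).

Lemma plateau_integral_le n : ((\int[P]_x plateau g n x)%:E <= P [set x | (0 < g x)%R])%E.
Proof.
apply: (cvge_to_ge (cvg_plateau_integral cg g0)).
exists n => // m /= nm; rewrite lee_fin; apply: le_Rintegral => //.
- by apply: probability_integrable; [exact: continuous_plateau|exact: bounded_plateau].
- by apply: probability_integrable; [exact: continuous_plateau|exact: bounded_plateau].
- by move=> x _; exact: plateau_homo.
Qed.

Lemma plateau_integral_gt (c : R) : (c%:E < P [set x | (0 < g x)%R])%E ->
  exists n, c < \int[P]_x plateau g n x.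
Proof.
move=> cP; apply: contrapT => /forallNP nc.
suff : (P [set x | (0 < g x)%R] <= c%:E)%E by rewrite leNgt cP.
apply: (cvge_to_le (cvg_plateau_integral cg g0)).
by apply: nearW => n /=; rewrite lee_fin leNgt; exact/negP.
Qed.

End plateau_integral_bounds.

(** * Separable metric spaces *)

Section metric.
Context {R : realType} {X : metricType R}.

Lemma lipschitz_continuous (f : X -> R) :
  (forall x y, f x <= mdist x y + f y) -> continuous f.
Proof.
move=> fl x; apply/cvgrPdist_lt => e e0.
near=> y.
have xy : mdist x y < e.
  near: y; have := nbhsx_ballx x e e0; rewrite ballEmdist.
  by apply: filterS.
rewrite ltr_norml; apply/andP; split.
  by have := fl y x; rewrite metric_sym; lra.
by have := fl x y; lra.
Unshelve. all: by end_near. Qed.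

Definition tent (a : X) (r : R) (x : X) : R := Num.max 0 (r - mdist a x).

Lemma tent_ge0 a r x : 0 <= tent a r x. Proof. by rewrite le_max lexx. Qed.

Lemma tent_gt0 a r x : (0 < tent a r x) = (mdist a x < r).
Proof. by rewrite lt_max ltxx/= subr_gt0. Qed.

Lemma continuous_tent a r : continuous (tent a r).
Proof.
apply: lipschitz_continuous => x y.
rewrite ge_max addr_ge0 ?mdist_ge0 ?tent_ge0//=.
have : r - mdist a y <= tent a r y by rewrite le_max lexx orbT.
have := metric_triangle a x y; lra.
Qed.

(** The distance to A, truncated at 1 so that it is defined, and positive, also
    when A is empty. *)
Definition setdist (A : set X) (x : X) : R :=
  inf [set d | d = 1 \/ exists2 y, A y & d = mdist x y].

Let has_inf_setdist (A : set X) x :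
  has_inf [set d | d = 1 \/ exists2 y, A y & d = mdist x y].
Proof.
split; first by exists 1; left.
by exists 0 => _ [->//|[y _ ->]]; exact: mdist_ge0.
Qed.

Lemma setdist_ge0 A x : 0 <= setdist A x.
Proof.
apply: lb_le_inf; first by case: (has_inf_setdist A x).
by move=> _ [->//|[y _ ->]]; exact: mdist_ge0.
Qed.

Lemma continuous_setdist A : continuous (setdist A).
Proof.
apply: lipschitz_continuous => x y; rewrite addrC -lerBlDr.
apply: lb_le_inf; first by case: (has_inf_setdist A y).
move=> d [->|[z Az ->]]; rewrite lerBlDr.
  apply: (@le_trans _ _ 1); last by rewrite lerDl mdist_ge0.
  by apply: ge_inf; [case: (has_inf_setdist A x)|left].
apply: (@le_trans _ _ (mdist x z)); last by rewrite addrC metric_triangle.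
by apply: ge_inf; [case: (has_inf_setdist A x)|right; exists z].
Qed.

Lemma setdist_gt0 (U : set X) : open U -> [set x | 0 < setdist (~` U) x] = U.
Proof.
move=> oU; apply/seteqP; split => x /=.
  apply: contraPP => Ux; apply/negP; rewrite -leNgt.
  apply: ge_inf; first by case: (has_inf_setdist (~` U) x).
  by right; exists x => //; rewrite mdistxx.
move=> Ux; have /nbhs_ballP[e /= e0 eU] : nbhs x U by exact: open_nbhs_nbhs.
apply: (@lt_le_trans _ _ (Num.min 1 e)); first by rewrite lt_min ltr01.
apply: lb_le_inf; first by case: (has_inf_setdist (~` U) x).
move=> d [->|[y Uy ->]]; first by rewrite ge_min lexx.
rewrite ge_min; apply/orP; right; rewrite leNgt; apply/negP => xy; apply: Uy.
by apply: eU; rewrite ballEmdist.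
Qed.

End metric.

Section separable.
Context {R : realType}.

Lemma dense_seq (X : polishMetricType R) :
  exists a : nat -> X, forall x (e : R), 0 < e -> exists i, mdist (a i) x < e.
Proof.
have [D cD dD] := @separable_subproof R X.
have ball0 x (e : R) : 0 < e -> exists2 y, D y & mdist y x < e.
  move=> e0; have [|//|y [/interior_subset yx Dy]] := dD (ball x e)°.
    by exists x; exact: nbhsx_ballx.
    exact: open_interior.
  by exists y => //; move: yx; rewrite ballEmdist/= metric_sym.
have /pfcard_geP[D0|[a]] := cD.
  by have [|y] := ball0 point 1; [|rewrite D0].
exists a => x e /(ball0 x)[y Dy yx].
by have [i _ iy] := 'oinvP_a Dy; exists i; rewrite iy.
Qed.

Lemma polish_cozero_base (X : polishMetricType R) :
  exists g : nat -> X -> R, cozero_base g.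
Proof.
have [a da] := dense_seq X.
pose g n : X -> R := if (unpickle n : option (nat * nat)) is Some (i, k)
  then tent (a i) k.+1%:R^-1 else cst 0.
exists g; split.
- rewrite /g => n; case: unpickle => [[i k]|]; first exact: continuous_tent.
  by move=> x; exact: cvg_cst.
- by rewrite /g => n x; case: unpickle => [[i k]|//]; exact: tent_ge0.
- move=> U x oU Ux.
  have /nbhs_ballP[e /= e0 eU] : nbhs x U by exact: open_nbhs_nbhs.
  have [k ke] : exists k : nat, k.+1%:R^-1 < e / 2.
    have [|k] := @ltr_add_invr R 0 (e / 2); first by rewrite divr_gt0.
    by rewrite add0r; exists k.
  have [i ix] := da x k.+1%:R^-1 ltac:(by rewrite invr_gt0).
  exists (pickle (i, k)); rewrite /g pickleK; split; first by rewrite tent_gt0.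
  move=> y /=; rewrite tent_gt0 => iy; apply: eU; rewrite ballEmdist/=.
  rewrite (le_lt_trans (metric_triangle x (a i) y))// metric_sym.
  by rewrite [e]splitr ltrD// (lt_trans _ ke).
Qed.

Lemma prod_cozero_base {S T : topologicalType} (g : nat -> S -> R) (h : nat -> T -> R) :
  cozero_base g -> cozero_base h ->
  exists k : nat -> S * T -> R, cozero_base k.
Proof.
move=> [cg g0 gU] [ch h0 hU].
pose k n : S * T -> R := if (unpickle n : option (nat * nat)) is Some (i, j)
  then (fun p => Num.min (g i p.1) (h j p.2)) else cst 0.
exists k; split.
- rewrite /k => n; case: unpickle => [[i j]|]; last by move=> x; exact: cvg_cst.
  move=> p; apply: (@continuous_min _ _ (g i \o fst) (h j \o snd)).
    by apply: continuous_comp; [exact: cvg_fst|exact: cg].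
  by apply: continuous_comp; [exact: cvg_snd|exact: ch].
- rewrite /k => n p; case: unpickle => [[i j]|//].
  by rewrite le_min g0 h0.
- move=> U [x y] oU Uxy.
  have [[A B] /= [xA yB] ABU] : nbhs (x, y) U by exact: open_nbhs_nbhs.
  have [i [gix giA]] := gU A° x (open_interior _) xA.
  have [j [hjy hjB]] := hU B° y (open_interior _) yB.
  exists (pickle (i, j)); rewrite /k pickleK; split; first by rewrite lt_min gix hjy.
  move=> [x' y']; rewrite /= lt_min => /andP[gx' hy']; apply: ABU; split => /=.
    exact: interior_subset (giA _ gx').
  exact: interior_subset (hjB _ hy').
Qed.

End separable.

(** * Tightness and Daniell continuity *)

Section tightness.
Context {R : realType}.

(** A functional form of tightness: the law is concentrated, up to e, where f
    is positive, and this set is covered by finitely many balls of radius r.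
    Intersecting over radii tending to 0 yields a totally bounded set, so that
    compact sets need not be mentioned. *)
Lemma tight_function (X : polishMetricType R) (P : probability (borel X) R) (r e : R) :
  0 < r -> 0 < e -> exists2 f : X -> R,
    continuous f /\ (forall x, 0 <= f x <= 1) &
    1 - e < \int[P]_x f x /\
    exists s : seq X, forall x, 0 < f x -> exists2 a, a \in s & mdist a x < r.
Proof.
move=> r0 e0; have [a da] := dense_seq X.
pose g n x : R := \sum_(i < n) tent (a i) r x.
have g0 n x : 0 <= g n x by apply: sumr_ge0 => i _; exact: tent_ge0.
have cg n : continuous (g n).
  by apply: (continuous_sum (F := fun i => tent (a i) r)) => i; exact: continuous_tent.
pose G n : set (borel X) := [set x | 0 < g n x].
have GT : \bigcup_n G n = setT.
  apply/seteqP; split => // x _; have [i ix] := da x _ r0.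
  exists i.+1 => //; rewrite /G/= /g big_ord_recr/= ltr_wpDl//.
    by apply: sumr_ge0 => j _; exact: tent_ge0.
  by rewrite tent_gt0.
have mG n : measurable (G n) by apply: open_borel; exact: open_cozero.
have ndG : nondecreasing_seq G.
  apply/nondecreasing_seqP => n; apply/subsetPset => x; rewrite /G/= /g big_ord_recr/=.
  by move=> /lt_le_trans; apply; rewrite lerDl tent_ge0.
have PG : P (G n) @[n --> \oo] --> 1%E.
  have := @nondecreasing_cvg_mu _ _ _ P G mG _ ndG.
  by rewrite GT -(probability_setT P); apply => //; exact: measurableT.
have [n Pn] : exists n, ((1 - e)%:E < P (G n))%E.
  apply: contrapT => /forallNP nP.
  suff : (1%:E <= (1 - e)%:E :> \bar R)%E by rewrite lee_fin; lra.
  apply: (cvge_to_le PG).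
  by apply: nearW => n /=; rewrite leNgt; exact/negP.
have [k ek] := plateau_integral_gt (cg n) (g0 n) Pn.
exists (plateau (g n) k).
  split; first exact: continuous_plateau.
  by move=> x; exact: plateau_itv.
split => //; exists [seq a i | i <- iota 0 n] => x kx.
have gx : 0 < g n x.
  apply: contrapT => gx; move: kx; rewrite plateau_eq0 ?ltxx//.
apply: contrapT => nx; move: gx; rewrite /g big1 ?ltxx// => i _.
apply/le_anti; rewrite tent_ge0 andbT leNgt; apply/negP; rewrite tent_gt0 => ix.
by apply: nx; exists (a i) => //; apply: map_f; rewrite mem_iota/= add0n.
Qed.

Lemma ultra_mem_seq {I : Type} {S : eqType} (U : set_system I) (s : seq S) (A : S -> set I) :
  UltraFilter U -> U [set m | exists2 a, a \in s & A a m] ->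
  exists2 a, a \in s & U (A a).
Proof.
move=> UU; elim: s => [|b s IHs] Us.
  by exfalso; apply: (@filter_not_empty _ U _); apply: filterS Us => m [].
have [Ub|Ub] := in_ultra_setVsetC (A b) UU.
  by exists b => //; rewrite mem_head.
have [|a sa Ua] := IHs; last by exists a => //; rewrite in_cons sa orbT.
apply: filterS (filterI Us Ub) => m [[a + Am] nAm].
by rewrite in_cons => /predU1P[ab|sa]; [rewrite ab in Am|exists a].
Qed.

(** Among finitely many balls covering the sequence along the ultrafilter, one
    contains it along the ultrafilter; hence its image is a Cauchy filter. *)
Lemma ultra_totally_bounded_cvg (X : polishMetricType R) {I : Type} (U : set_system I)
    (x : I -> X) : UltraFilter U ->
  (forall e : R, 0 < e -> exists s : seq X, U [set m | exists2 a, a \in s & mdist a (x m) < e]) ->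
  exists l : X, x @ U --> l.
Proof.
move=> UU xU; apply/cvg_ex; apply: cauchy_cvg; apply: (@cauchy_exP R) => e e0.
have [s Us] := xU _ e0.
have [a _ Ua] := ultra_mem_seq (A := fun a m => mdist a (x m) < e) UU Us.
by exists a; rewrite ballEmdist.
Qed.

Section marginals.
Variables (X Y : polishMetricType R).
Variables (P : probability (borel X) R) (Q : probability (borel Y) R).
Variables (L : (X * Y -> R) -> R) (mL : is_mean L).
Hypothesis LP : forall f : X -> R, continuous f -> bounded_fun f ->
  L (f \o fst) = \int[P]_x f x.
Hypothesis LQ : forall f : Y -> R, continuous f -> bounded_fun f ->
  L (f \o snd) = \int[Q]_x f x.

(** Suppose that L (h m) >= e for all m. Let u i and v i be tight functions on
    X and Y at radius 1/(i+1), with a loss of mass summable to at most e/2 in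
    total. If every point p had h m p <= e/4 or u i p.1 = 0 or v i p.2 = 0 for
    some i < m, then h m would be at most e/4 plus the sum of all losses up to
    m, whose mean is less than e. So there is p m with h m (p m) > e/4 whose
    coordinates satisfy the first m total boundedness conditions. Along an
    ultrafilter p m converges, by completeness, to a point where no h k is less
    than e/4. *)
Lemma marginals_daniell_continuous : daniell_continuous L.
Proof.
move=> h ch h01 hn hx e e0; apply: contrapT => /forallNP nLh.
have Lh n : e <= L (h n) by rewrite leNgt; exact/negP.
have e2 i : 0 < e / 4 / (2 ^ i.+1)%:R :> R.
  by rewrite !divr_gt0// ltr0n expn_gt0.
have i0 (i : nat) : 0 < i.+1%:R^-1 :> R by rewrite invr_gt0.
have /choice[u hu] : forall i : nat, exists f : X -> R,
    [/\ continuous f, forall x, 0 <= f x <= 1, 1 - e / 4 / (2 ^ i.+1)%:R < \int[P]_x f x &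
     exists s : seq X, forall x, 0 < f x -> exists2 a, a \in s & mdist a x < i.+1%:R^-1].
  by move=> i; have [f [cf f01] [fP fs]] := tight_function P (i0 i) (e2 i); exists f.
have /choice[v hv] : forall i : nat, exists f : Y -> R,
    [/\ continuous f, forall x, 0 <= f x <= 1, 1 - e / 4 / (2 ^ i.+1)%:R < \int[Q]_x f x &
     exists s : seq Y, forall x, 0 < f x -> exists2 a, a \in s & mdist a x < i.+1%:R^-1].
  by move=> i; have [f [cf f01] [fP fs]] := tight_function Q (i0 i) (e2 i); exists f.
have bu i : bounded_fun (u i).
  by apply: (@bounded_fun_itv _ _ _ 0 1) => x; have [_ u01 _ _] := hu i; exact: u01.
have bv i : bounded_fun (v i).
  by apply: (@bounded_fun_itv _ _ _ 0 1) => x; have [_ v01 _ _] := hv i; exact: v01.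
have bh n : bounded_fun (h n) by apply: (@bounded_fun_itv _ _ _ 0 1).
(* The loss at scale i: it is at least 1 where u i or v i vanishes. *)
pose w i (p : X * Y) : R := (1 - u i p.1) + (1 - v i p.2).
have bw i : bounded_fun (w i).
  apply: bounded_funD; apply: bounded_funB; do ?exact: bounded_fun_cst.
    exact: (bounded_fun_comp fst (bu i)).
  exact: (bounded_fun_comp snd (bv i)).
have w0 i p : 0 <= w i p.
  have [_ /(_ p.1)/andP[_ u1] _ _] := hu i; have [_ /(_ p.2)/andP[_ v1] _ _] := hv i.
  by rewrite addr_ge0// subr_ge0.
have Lw i : L (w i) <= e / 2 / (2 ^ i.+1)%:R.
  have [cu _ uP _] := hu i; have [cv _ vQ _] := hv i.
  have -> : w i = (cst 1 \- (u i \o fst)) \+ (cst 1 \- (v i \o snd)) by [].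
  have b1 : bounded_fun (cst 1 : X * Y -> R) by exact: bounded_fun_cst.
  have bu1 : bounded_fun (u i \o fst : X * Y -> R) by exact: bounded_fun_comp.
  have bv1 : bounded_fun (v i \o snd : X * Y -> R) by exact: bounded_fun_comp.
  rewrite (meanD mL); [|exact: bounded_funB..].
  rewrite !(meanB mL)// (mean_cst mL) LP// LQ//.
  have : e / 4 / (2 ^ i.+1)%:R + e / 4 / (2 ^ i.+1)%:R = e / 2 / (2 ^ i.+1)%:R :> R by lra.
  lra.
have Lsum n : \sum_(i < n) L (w i) <= e / 2.
  apply: (@le_trans _ _ (\sum_(i < n) e / 2 / (2 ^ i.+1)%:R)); first exact: ler_sum.
  suff -> : \sum_(i < n) e / 2 / (2 ^ i.+1)%:R = e / 2 - e / 2 / (2 ^ n)%:R :> R.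
    by rewrite gerBl divr_ge0// divr_ge0// ltW.
  elim: n => [|n IHn]; first by rewrite big_ord0 expn0 divr1 subrr.
  rewrite big_ord_recr/= IHn expnS natrM invfM; lra.
have /choice[p hp] : forall m : nat, exists p : X * Y,
    e / 4 < h m p /\ forall i, (i < m)%N -> 0 < u i p.1 /\ 0 < v i p.2.
  move=> m; apply: contrapT => /forallNP np.
  have [bS LS] := mean_sum mL m bw.
  have : L (h m) <= L (cst (e / 4) \+ (fun p => \sum_(i < m) w i p)).
    have bc : bounded_fun (cst (e / 4) : X * Y -> R) by exact: bounded_fun_cst.
    apply: (le_mean mL) => //; first exact: bounded_funD.
    move=> p; have sp : 0 <= \sum_(i < m) w i p by apply: sumr_ge0.
    rewrite /=; have [hp|hp] := leP (h m p) (e / 4); first by rewrite -[leLHS]addr0 lerD.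
    have [i im wi] : exists2 i, (i < m)%N & 1 <= w i p.
      have /not_andP[//|/existsNP[i /not_implyP[im uv]]] := np p.
      exists i => //.
      have [_ /(_ p.1)/andP[u0 u1] _ _] := hu i; have [_ /(_ p.2)/andP[v0 v1] _ _] := hv i.
      have [ui|] := ltP 0 (u i p.1); have [vi|] := ltP 0 (v i p.2).
      - by exfalso; apply: uv.
      - by rewrite /w; lra.
      - by rewrite /w; lra.
      - by rewrite /w; lra.
    have /andP[_ h1] := h01 m p.
    rewrite (bigD1 (Ordinal im))//=.
    have : 0 <= \sum_(j < m | j != Ordinal im) w j p by apply: sumr_ge0.
    by lra.
  rewrite (meanD mL)//; last exact: bounded_fun_cst.
  rewrite LS (mean_cst mL); have := Lh m; have := Lsum m; lra.
have [U [UU ooU]] := ultraFilterLemma (@eventually_filter).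
have ultra_gt k : U [set m | (k < m)%N] by apply: ooU; exists k.+1.
have tb (d : R) : 0 < d -> exists k : nat, k.+1%:R^-1 < d.
  by move=> d0; have [//|k] := @ltr_add_invr R 0 d; rewrite add0r; exists k.
have [x px] : exists x : X, (fst \o p) @ U --> x.
  apply: ultra_totally_bounded_cvg => d /tb[k kd].
  have [_ _ _ [s us]] := hu k; exists s.
  apply: filterS (ultra_gt k) => m km.
  have [_ /(_ _ km)[/us[a sa am] _]] := hp m.
  by exists a => //; exact: lt_trans kd.
have [y py] : exists y : Y, (snd \o p) @ U --> y.
  apply: ultra_totally_bounded_cvg => d /tb[k kd].
  have [_ _ _ [s vs]] := hv k; exists s.
  apply: filterS (ultra_gt k) => m km.
  have [_ /(_ _ km)[_ /vs[a sa am]]] := hp m.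
  by exists a => //; exact: lt_trans kd.
have pxy : p @ U --> (x, y).
  have -> : p = (fun m => ((fst \o p) m, (snd \o p) m)).
    by apply/funext => m /=; case: (p m).
  exact: cvg_pair.
have [k hk] : exists k, h k (x, y) < e / 4 by apply: hx; rewrite divr_gt0.
suff : e / 4 <= h k (x, y) by rewrite leNgt hk.
have hkp : h k \o p @ U --> h k (x, y) by apply: continuous_cvg => //; exact: ch.
apply: (cvgr_to_ge hkp); apply: filterS (ultra_gt k) => m /= km.
have [/ltW + _] := hp m; move/le_trans; apply.
have : {homo (fun n => h n (p m)) : i j / (i <= j)%N >-> j <= i}.
  apply: (@homo_leq _ _ (fun a b : R => b <= a)) => [a|b a c /[swap]|n].
  - exact: lexx.
  - exact: le_trans.
  - exact: hn.
by apply; exact: ltnW.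
Qed.

End marginals.
End tightness.

(** * Couplings represented by means *)

Section marginal_uniqueness.
Context {R : realType}.

(** Taking complements, Q <= P on closed sets; an open set is an increasing
    union of closed sets, so the reverse inequality holds on open sets too, and
    they form a pi-system that generates the Borel sets. *)
Lemma probability_eq_of_le_open (X : polishMetricType R) (P Q : probability (borel X) R) :
  (forall U : set X, open U -> (P U <= Q U)%E) ->
  forall A, measurable A -> P A = Q A.
Proof.
move=> PQ.
suff QP (U : set X) : open U -> (Q U <= P U)%E.
  move=> A mA; apply: (@measure_unique _ R (borel X) (@open X) (fun=> setT)) => //.
  - by move=> U V; exact: openI.
  - by move=> _; exact: openT.
  - by rewrite bigcup_const//; exists 0%N.
  - by move=> U oU; apply/eqP; rewrite eq_le PQ// QP.
  - by move=> _; rewrite -ge0_fin_numE// fin_num_measure.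
move=> oU; pose g := setdist (~` U).
pose C (n : nat) : set (borel X) := [set x | n.+1%:R^-1 <= g x].
have oC n : open (~` C n : set X).
  rewrite (_ : ~` _ = g @^-1` [set x | x < n.+1%:R^-1]).
    by apply: open_comp => [x _|]; [exact: continuous_setdist|exact: open_lt].
  by apply/seteqP; split => x /=; [move/negP; rewrite -ltNge|rewrite ltNge => /negP].
have mC n : measurable (C n) by rewrite -[C n]setCK; apply: measurableC; exact: open_borel.
have CU : \bigcup_n C n = U.
  rewrite -(setdist_gt0 oU) -/g; apply/seteqP; split => x.
    by move=> [n _]; apply: lt_le_trans; rewrite invr_gt0.
  move=> /= gx; have [//|k] := @ltr_add_invr R 0 (g x); rewrite add0r => kx.
  by exists k => //; exact: ltW.
have ndC : nondecreasing_seq C.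
  apply/nondecreasing_seqP => n; apply/subsetPset => x; apply: le_trans.
  by rewrite lef_pV2 ?posrE// ler_nat.
have CP n : (Q (C n) <= P U)%E.
  apply: (@le_trans _ _ (P (C n))).
    have mCC : measurable (~` C n) by exact: measurableC.
    rewrite -[C n]setCK (probability_setC P mCC) (probability_setC Q mCC).
    by apply: leeB => //; exact: PQ.
  by apply: le_measure; rewrite ?inE//; [exact: open_borel|rewrite -CU; exact: bigcup_sup].
have := @nondecreasing_cvg_mu _ _ _ Q C mC _ ndC.
rewrite CU => /(_ (open_borel oU)) QU; apply: (cvge_to_le QU).
by apply: nearW => n; exact: CP.
Qed.

End marginal_uniqueness.

Lemma continuous_borel_measurable_map {S T : ptopologicalType} (f : S -> T) :
  continuous f -> measurable_fun [set: borel S] (f : borel S -> borel T).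
Proof.
move=> cf.
apply: (@measurability _ _ (borel S) (borel T) setT f (@open T) erefl) => _ [U oU <-].
by rewrite setTI; apply: open_borel; apply: open_comp => // x _; exact: cf.
Qed.

Lemma pushforward_probability {R : realType} {d d'} {S : measurableType d} {T : measurableType d'}
    (m : probability S R) (f : S -> T) : measurable_fun setT f ->
  exists m' : probability T R, forall A, m' A = m (f @^-1` A).
Proof.
move=> mf; pose f' : {mfun S >-> T} := HB.pack f (isMeasurableFun.Build _ _ _ _ f mf).
by exists (distribution m f').
Qed.

Section mean_coupling.
Context {R : realType}.

(** An open set of X is the cozero set of the distance to its complement, whose
    plateau functions have P-integral at most the mass of the set. So the image
    of m is at most P on open sets, hence equal to P. *)
Lemma mean_marginal {T : ptopologicalType} (X : polishMetricType R) (L : (T -> R) -> R)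
    (m : probability (borel T) R) (P : probability (borel X) R) (h : T -> X) :
  (forall g : T -> R, continuous g -> (forall x, 0 <= g x)%R ->
    forall r : R, (forall n, L (plateau g n) <= r)%R ->
    (m [set x | (0 < g x)%R] <= r%:E)%E) ->
  continuous h ->
  (forall f : X -> R, continuous f -> bounded_fun f -> L (f \o h) = \int[P]_x f x) ->
  forall A : set (borel X), measurable A -> m (h @^-1` A) = P A.
Proof.
move=> mle ch LP.
have [m' m'E] := pushforward_probability m (continuous_borel_measurable_map ch).
move=> A mA; rewrite -m'E; apply: probability_eq_of_le_open => // U oU.
rewrite m'E -(setdist_gt0 oU); set g := setdist (~` U).
have cg : continuous g by exact: continuous_setdist.
have g0 x : 0 <= g x by exact: setdist_ge0.
have Pfin : P [set x | (0 < g x)%R] \is a fin_num.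
  by apply: fin_num_measure; rewrite setdist_gt0//; exact: open_borel.
rewrite -[leRHS]fineK//.
apply: (mle (g \o h)) => [|x|n]; [|exact: g0|].
  by move=> x; apply: continuous_comp; [exact: ch|exact: cg].
rewrite (_ : plateau _ n = plateau g n \o h)// LP; last 2 first.
  exact: continuous_plateau.
  exact: bounded_plateau.
by rewrite -lee_fin (le_trans (plateau_integral_le P cg g0 n))// fineK.
Qed.

Variables (X Y : polishMetricType R).
Variables (P : probability (borel X) R) (Q : probability (borel Y) R).
Variables (L : (X * Y -> R) -> R) (mL : is_mean L).
Hypothesis LP : forall f : X -> R, continuous f -> bounded_fun f ->
  L (f \o fst) = \int[P]_x f x.
Hypothesis LQ : forall f : Y -> R, continuous f -> bounded_fun f ->
  L (f \o snd) = \int[Q]_x f x.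

Lemma mean_coupling : exists m : probability (borel (X * Y)%type) R,
  [/\ forall A : set (borel X), measurable A -> m (fst @^-1` A) = P A,
      forall A : set (borel Y), measurable A -> m (snd @^-1` A) = Q A &
      forall g : X * Y -> R, continuous g -> (forall p, 0 <= g p)%R ->
        (0 < m [set p | (0 < g p)%R])%E -> exists n, (0 < L (plateau g n))%R].
Proof.
have [gX bX] := polish_cozero_base X; have [gY bY] := polish_cozero_base Y.
have [gXY bXY] := prod_cozero_base bX bY.
have [m mle] := daniell_measure (T := (X * Y)%type) mL
  (marginals_daniell_continuous mL LP LQ) bXY.
exists m; split.
- by apply: (mean_marginal mle) => // x; exact: cvg_fst.
- by apply: (mean_marginal mle) => // x; exact: cvg_snd.
- move=> g cg g0 mg; apply: contrapT => /forallNP nL; move: mg.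
  apply/negP; rewrite -leNgt; apply: (mle _ cg g0) => n.
  by rewrite leNgt; exact/negP.
Qed.

End mean_coupling.

(** * Limits of means along an ultrafilter *)

Section ultralimit.
Context {R : realType} {I : Type} (U : set_system I) (UU : UltraFilter U).

Lemma ultra_fmap {J : Type} (f : I -> J) : UltraFilter (f @ U).
Proof.
split=> [|G PG UG]; first exact: fmap_proper_filter.
apply/seteqP; split => // A GA.
have [//|UA] := in_ultra_setVsetC (f @^-1` A) UU.
exfalso; have GCA : G (~` A) by apply: UG.
by apply: (@filter_not_empty _ G _); apply: filterS (filterI GA GCA) => x [].
Qed.

Lemma ultra_bounded_cvg (u : I -> R) : bounded_fun u -> cvg (u @ U).
Proof.
move=> /bounded_funE[M uM]; apply/cvg_ex.
have : compact `[- M, M]%classic by exact: segment_compact.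
rewrite compact_ultra; have uU := ultra_fmap u.
move=> /(_ (u @ U) uU)[|l [_ ul]]; last by exists l.
by apply: (@filterE _ U) => k /=; rewrite in_itv/= -ler_norml; exact: uM.
Qed.

Lemma mean_norm_le {T : Type} (L : (T -> R) -> R) (f : T -> R) (M : R) :
  is_mean L -> (forall x, `|f x| <= M) -> `|L f| <= M.
Proof.
move=> mL fM; have bf : bounded_fun f by apply/bounded_funE; exists M.
have bM c : bounded_fun (cst c : T -> R) by exact: bounded_fun_cst.
rewrite ler_norml; apply/andP; split.
  rewrite -[leLHS](mean_cst mL); apply: (le_mean mL) => // x.
  by have := fM x; rewrite ler_norml => /andP[].
rewrite -[leRHS](mean_cst mL); apply: (le_mean mL) => // x.
by have := fM x; rewrite ler_norml => /andP[].
Qed.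

Lemma bounded_mean_seq {T : Type} (L : I -> (T -> R) -> R) (f : T -> R) :
  (forall k, is_mean (L k)) -> bounded_fun f -> bounded_fun (L^~ f).
Proof.
move=> mL /bounded_funE[M fM]; apply/bounded_funE; exists M => k.
exact: mean_norm_le.
Qed.

Lemma ultralimit_mean {T : Type} (L : I -> (T -> R) -> R) :
  (forall k, is_mean (L k)) -> is_mean (fun f => lim (L k f @[k --> U])).
Proof.
move=> mL; have cL f : bounded_fun f -> cvg (L k f @[k --> U]).
  by move=> bf; apply: ultra_bounded_cvg; exact: bounded_mean_seq.
split.
- move=> f g bf bg; rewrite (_ : (fun k => L k (f \+ g)) = (L^~ f) + (L^~ g)); last first.
    by apply/funext => k; rewrite (meanD (mL k)).
  by apply: limD; exact: cL.
- move=> f bf f0; apply: limr_ge; first exact: cL.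
  by apply: nearW => k; exact: (mean_ge0 (mL k)).
- move=> c; rewrite (_ : (fun k => L k (cst c)) = cst c); last first.
    by apply/funext => k; rewrite (mean_cst (mL k)).
  by apply: cvg_lim => //; exact: cvg_cst.
Qed.

Lemma ultralimit_mean_gt0 {T : Type} (L : I -> (T -> R) -> R) f :
  (forall k, is_mean (L k)) -> bounded_fun f ->
  0 < lim (L k f @[k --> U]) -> U [set k | 0 < L k f].
Proof.
move=> mL bf L0; have cL : cvg (L k f @[k --> U]).
  by apply: ultra_bounded_cvg; exact: bounded_mean_seq.
exact: (cvgr_gt _ cL _ L0).
Qed.

End ultralimit.

Section coupling_of_sequences.
Context {R : realType} {B : polishMetricType R} (X Y : mmField B).

(** The mean is the iterated limit along an ultrafilter U of the averages over
    the first n + 1 pairs of the k-th sequences, first in n and then in k. The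
    average over no pair is not a mean, whence the shift. If the measure of a
    cozero set is positive, then so is the limit mean of a plateau function, and
    hence the latter takes a positive value along the k-th sequences for a set
    of indices k that belongs to U. *)
Lemma coupling_of_sequences (x : nat -> nat -> X) (y : nat -> nat -> Y) :
  (forall k, uniformly_distributed X (x k)) ->
  (forall k, uniformly_distributed Y (y k)) ->
  exists (m : probability (borel (X * Y)%type) R) (U : set_system nat),
    [/\ couplings X Y m, ProperFilter U, \oo `<=` U &
      forall g : X * Y -> R, continuous g -> (forall p, 0 <= g p)%R ->
        (0 < m [set p | (0 < g p)%R])%E ->
        U [set k | exists i, (0 < g (x k i, y k i))%R]].
Proof.
move=> ux uy; have [U [UU ooU]] := ultraFilterLemma (@eventually_filter).
pose A k n (f : X * Y -> R) : R := average (fun i => (x k i, y k i) : X * Y) n.+1 f.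
have mA k n : is_mean (A k n) by exact: average_mean.
pose L1 k f := lim (A k n f @[n --> U]).
have mL1 k : is_mean (L1 k) by exact: ultralimit_mean.
pose L f := lim (L1 k f @[k --> U]).
have mL : is_mean L by exact: ultralimit_mean.
have PU : ProperFilter U by exact: ultra_proper.
have limU (u : nat -> R) l : u n @[n --> \oo] --> l -> lim (u n @[n --> U]) = l.
  by move=> ul; apply: cvg_lim => //; move=> V /ul; exact: ooU.
have LX (f : X -> R) : continuous f -> bounded_fun f -> L (f \o fst) = \int[mm_law X]_z f z.
  move=> cf bf; rewrite /L (_ : (fun k => _) = cst (\int[mm_law X]_z f z)); last first.
    apply/funext => k /=; apply: limU.
    have /weakly_convergesE/(_ f cf bf) xf := ux k.
    by move: xf; rewrite -(@cvg_shiftS _ (fun n => average (x k) n f)).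
  by apply: limU; exact: cvg_cst.
have LY (f : Y -> R) : continuous f -> bounded_fun f -> L (f \o snd) = \int[mm_law Y]_z f z.
  move=> cf bf; rewrite /L (_ : (fun k => _) = cst (\int[mm_law Y]_z f z)); last first.
    apply/funext => k /=; apply: limU.
    have /weakly_convergesE/(_ f cf bf) yf := uy k.
    by move: yf; rewrite -(@cvg_shiftS _ (fun n => average (y k) n f)).
  by apply: limU; exact: cvg_cst.
have [m [mX mY mg]] := mean_coupling mL LX LY.
exists m, U; split => // g cg g0 /(mg _ cg g0)[n Lg].
have bg : bounded_fun (plateau g n) by exact: bounded_plateau.
have := ultralimit_mean_gt0 UU mL1 bg Lg.
apply: filterS => k /= L1g.
have := ultralimit_mean_gt0 UU (mA k) bg L1g.
move=> /filter_ex[j /= Ag]; apply: contrapT => /forallNP nk; move: Ag.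
rewrite /A /average big1 ?mulr0 ?ltxx// => i _.
by rewrite plateau_eq0.
Qed.

End coupling_of_sequences.

(** * Weak convergence from frequencies of open sets *)

Section layers.
Context {R : realType}.

(** The sum counts the positive integers less than t, which is the integer part
    of t up to rounding. *)
Lemma layer_count (t : R) (K : nat) : 0 <= t <= K%:R ->
  t - 1 <= \sum_(j < K) (j.+1%:R < t)%R%:R <= t.
Proof.
move=> /andP[t0 tK].
have count_le n : \sum_(j < n) (j.+1%:R < t)%R%:R <= n%:R :> R.
  apply: (@le_trans _ _ (\sum_(j < n) 1)); first by apply: ler_sum => j _; case: (_ < _).
  by rewrite sumr_const card_ord.
apply/andP; split.
  have lb n : (n%:R < t -> n%:R <= \sum_(j < n) (j.+1%:R < t)%R%:R :> R) /\
      (t <= n%:R -> t - 1 <= \sum_(j < n) (j.+1%:R < t)%R%:R).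
    elim: n => [|n [IH1 IH2]].
      rewrite big_ord0; split=> [_//|]; lra.
    rewrite big_ord_recr/= -natr1; split => nt.
      by rewrite nt lerD2r; apply: IH1; lra.
    have -> : (n%:R + 1 < t) = false by apply/negbTE; rewrite -leNgt.
    rewrite addr0; have [/IH2//|/IH1] := leP t n%:R; lra.
  exact: (lb K).2.
elim: K {tK} => [|n IHn]; first by rewrite big_ord0.
rewrite big_ord_recr/=; have [nt|_] := ltP n.+1%:R t; last by rewrite addr0.
by rewrite (le_trans _ (ltW nt))// -natr1 lerD2r; exact: count_le.
Qed.

End layers.

Section portmanteau.
Context {R : realType} {T : ptopologicalType} (P : probability (borel T) R).
Variable z : nat -> T.
Hypothesis liminf_open : forall (U : set T) (e : R), open U -> 0 < e ->
  \forall n \near \oo, fine (P U) - e <= average z n (\1_U).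

(** By layer_count, f is within d of d times the sum of the indicators of the
    open sets where f exceeds d, 2d, ..., Kd, and is bounded below by it. So a
    lower bound for the averages of f follows from the same for open sets. *)
Let liminf_nonneg (f : T -> R) (M : R) : continuous f -> (forall x, 0 <= f x <= M) ->
  forall e, 0 < e -> \forall n \near \oo, \int[P]_x f x - e <= average z n f.
Proof.
move=> cf f0M e e0; have e20 : 0 < e / 2 by rewrite divr_gt0.
pose d := e / 2; pose K := (Num.truncn (M / d)).+1.
pose A j : set (borel T) := [set x | d * j.+1%:R < f x].
have oA j : open (A j : set T).
  rewrite (_ : A j = f @^-1` [set y | d * j.+1%:R < y])//.
  by apply: open_comp => [x _|]; [exact: cf|exact: open_gt].
have mA j : measurable (A j) by exact: open_borel.
have layer x : f x - d <= d * \sum_(j < K) \1_(A j) x <= f x.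
  have -> : \sum_(j < K) \1_(A j) x = \sum_(j < K) (j.+1%:R < f x / d)%R%:R :> R.
    apply: eq_bigr => j _; rewrite indicE ltr_pdivlMr// mulrC; congr (_%:R).
    by congr nat_of_bool; apply/idP/idP => [/set_mem//|h]; exact/mem_set.
  have /andP[f0 fM] := f0M x.
  have /andP[l1 l2] := @layer_count _ (f x / d) K ltac:(
    rewrite divr_ge0 ?(ltW e20)//=; apply: (le_trans _ (ltW (truncnS_gt _)));
    by rewrite ler_pM2r ?invr_gt0).
  apply/andP; split.
    rewrite (_ : f x - d = d * (f x / d - 1)) ?ler_pM2l//.
    by rewrite mulrBr mulr1 mulrCA divff ?mulr1// gt_eqF.
  by rewrite mulrC -ler_pdivlMr.
have intf : P.-integrable setT (EFin \o f).
  apply: probability_integrable => //.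
  exact: (@bounded_fun_itv _ _ _ 0 M).
have intf_le : \int[P]_x f x - d <= d * \sum_(j < K) fine (P (A j)).
  pose S x : R := \sum_(j < K) \1_(A j) x.
  have mS : measurable_fun [set: borel T] S.
    apply: measurable_sum => j; exact: measurable_indic.
  have SK x : 0 <= S x <= K%:R.
    rewrite sumr_ge0//=; apply: (@le_trans _ _ (\sum_(j < K) 1)).
      by apply: ler_sum => j _; rewrite indicE; case: (_ \in _).
    by rewrite sumr_const card_ord.
  have intS : P.-integrable setT (EFin \o S).
    apply: measurable_bounded_integrable => //.
      by rewrite -ge0_fin_numE// fin_num_measure.
    exact: (@bounded_fun_itv _ _ _ 0 K%:R).
  have intc (c : R) : P.-integrable setT (EFin \o cst c).
    by apply: probability_integrable; [move=> ?; exact: cvg_cst|exact: bounded_fun_cst].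
  have -> : \sum_(j < K) fine (P (A j)) = \int[P]_x S x.
    rewrite /Rintegral; under eq_integral do rewrite /S -sumEFin.
    rewrite ge0_integral_sum//; last first.
      by move=> j; apply/measurable_EFinP; exact: measurable_indic.
    rewrite (eq_bigr (fun j : 'I_K => (fine (P (A j)))%:E)) ?sumEFin// => j _.
    by rewrite integral_indic// setIT fineK// fin_num_measure.
  have intdS : P.-integrable setT (EFin \o (fun x => d * S x)).
    exact: (integrableZl measurableT d intS).
  rewrite -RintegralZl// lerBlDr -[X in _ <= _ + X]mulr1.
  have <- : fine (P setT) = 1 by rewrite probability_setT.
  rewrite -Rintegral_cst// -RintegralD//; last exact: (intc d).
  apply: le_Rintegral => //.
    rewrite (_ : EFin \o _ = (EFin \o (fun x => d * S x)) \+ (EFin \o cst d))//.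
      exact: integrableD.
  by move=> x _; have /andP[+ _] := layer x; rewrite lerBlDr.
have near_sum m (d' : R) : 0 < d' -> \forall n \near \oo,
    \sum_(j < m) fine (P (A j)) - d' <= \sum_(j < m) average z n (\1_(A j)).
  elim: m d' => [|m IHm] d' d'0.
    by apply: nearW => n; rewrite !big_ord0 sub0r oppr_le0 ltW.
  have d20 : 0 < d' / 2 by rewrite divr_gt0.
  near=> n; rewrite !big_ord_recr/=.
  have h1 : \sum_(j < m) fine (P (A j)) - d' / 2 <= \sum_(j < m) average z n (\1_(A j)).
    by near: n; exact: IHm.
  have h2 : fine (P (A m)) - d' / 2 <= average z n (\1_(A m)).
    by near: n; exact: liminf_open.
  rewrite [X in _ - X]splitr; lra.
apply: filterS (near_sum K 1 ltr01) => n h.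
have : d * \sum_(j < K) average z n (\1_(A j)) <= average z n f.
  rewrite /average -mulr_sumr mulrCA ler_wpM2l ?invr_ge0// exchange_big/= mulr_sumr.
  by apply: ler_sum => i _; have /andP[] := layer (z i).
have : d * (\sum_(j < K) fine (P (A j)) - 1) <= d * \sum_(j < K) average z n (\1_(A j)).
  by rewrite ler_pM2l.
have : e = d + d by rewrite /d -splitr.
rewrite mulrBr mulr1; lra.
Unshelve. all: by end_near. Qed.

(** The lower bound is applied to f + M and to M - f, which are nonnegative. *)
Lemma portmanteau : weakly_converges (empirical z) P.
Proof.
apply/weakly_convergesE => f cf bf; have /bounded_funE[M fM] := bf.
have cc (c : R) : continuous (cst c : T -> R) by move=> ?; exact: cvg_cst.
have bc (c : R) : bounded_fun (cst c : T -> R) by exact: bounded_fun_cst.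
have intf : P.-integrable setT (EFin \o f) by exact: probability_integrable.
have intc (c : R) : P.-integrable setT (EFin \o cst c) by exact: probability_integrable.
have Pc (c : R) : \int[P]_x (cst c x : R) = c.
  have PT : fine (P setT) = 1 by rewrite probability_setT.
  by rewrite -[RHS]mulr1 -PT -Rintegral_cst.
have fMM x : - M <= f x <= M by rewrite -ler_norml.
have up : continuous (f \+ cst M) by move=> x; apply: cvgD; [exact: cf|exact: cc].
have dn : continuous (cst M \- f) by move=> x; apply: cvgB; [exact: cc|exact: cf].
apply/cvgrPdist_le => e e0; near=> n.
have n0 : (0 < n)%N by near: n; exists 1%N.
have mn := @average_mean R _ z _ n0.
have : \int[P]_x (f \+ cst M) x - e <= average z n (f \+ cst M).
  near: n; apply: (liminf_nonneg (M := M + M)) => // x.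
  by have /andP[? ?] := fMM x; rewrite -lerBlDr sub0r lerD2r; apply/andP.
have : \int[P]_x (cst M \- f) x - e <= average z n (cst M \- f).
  near: n; apply: (liminf_nonneg (M := M + M)) => // x.
  by have /andP[? ?] := fMM x; rewrite subr_ge0/= lerD2l lerNl; apply/andP.
rewrite (meanD mn)// (meanB mn)// !(mean_cst mn).
have -> : \int[P]_x (f \+ cst M) x = \int[P]_x f x + M.
  by rewrite -[LHS]/(\int[P]_x (f x + cst M x)) RintegralD// Pc.
have -> : \int[P]_x (cst M \- f) x = M - \int[P]_x f x.
  by rewrite -[LHS]/(\int[P]_x (cst M x - f x)) RintegralB// Pc.
move=> h1 h2.
rewrite ler_norml; apply/andP; split; lra.
Unshelve. all: by end_near. Qed.

End portmanteau.

(** * Routing points down a binary tree *)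

Lemma cvg_natrV {R : realType} : n%:R^-1 @[n --> \oo] --> (0 : R).
Proof. by rewrite -(cvg_shiftS (fun n => n%:R^-1 : R)); exact: cvg_harmonic. Qed.

Section rotor_router.
Context {R : realType} (p : seq bool -> R).
Hypothesis p01 : forall w, 0 <= p w <= 1.

(** The number of the first n points that pass through the node w, where a word
    lists the turns from the node up to the root, the last turn first. Among k
    points reaching v, the integer part of k * p v turns to true. *)
Fixpoint visits (w : seq bool) (n : nat) : nat :=
  if w is b :: v then
    let k := Num.truncn ((visits v n)%:R * p v) in
    if b then k else (visits v n - k)%N
  else n.

(** The first m turns of the n-th point, the last turn first: it turns to true
    at a node when this is needed to keep the count prescribed by visits. *)
Fixpoint route (n m : nat) : seq bool :=
  if m is k.+1 then
    (visits (true :: route n k) n < visits (true :: route n k) n.+1)%N :: route n k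
  else [::].

Lemma size_route n m : size (route n m) = m.
Proof. by elim: m => //= m ->. Qed.

Lemma truncn_step (c : nat) (t : R) : 0 <= t <= 1 ->
  let k := Num.truncn (c%:R * t) in let k' := Num.truncn (c.+1%:R * t) in
  [/\ (k <= c)%N, (k <= k')%N & (k' <= k.+1)%N].
Proof.
move=> /andP[t0 t1] k k'; split.
- by rewrite truncn_le_nat (le_lt_trans (ler_piMr _ _))// ltr_nat.
- by apply: le_truncn; rewrite ler_wpM2r// ler_nat.
- rewrite truncn_le_nat -[c.+1%:R]natr1 mulrDl mul1r -[k.+2%:R]natr1.
  by apply: ltr_leD => //; exact: truncnS_gt.
Qed.

(** Since p v lies between 0 and 1, one more point at v raises the integer part
    of k * p v by 0 or 1; so exactly one child of v receives this point. *)
Lemma visits_step w n : visits w n.+1 = (visits w n + (route n (size w) == w))%N.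
Proof.
elim: w => [|b v IHv]; first by rewrite /= addn1.
have [h1 h2 h3] := truncn_step (visits v n) (p01 v).
move: h1 h2 h3; rewrite [visits (b :: v) n.+1]/= [size _]/= [route _ _]/= eqseq_cons IHv.
have [pv|npv] := eqVneq (route n (size v)) v; last first.
  by rewrite andbF !addn0.
rewrite pv andbT addn1 /= IHv pv eqxx addn1 => h1 h2 h3.
case: b => /=; lia.
Qed.

Lemma visits0 w : visits w 0 = 0%N.
Proof.
elim: w => [//|b v IHv] /=; rewrite IHv mul0r truncn0 sub0n.
by case: b.
Qed.

Lemma visits_sum w n : visits w n = (\sum_(i < n) (route i (size w) == w))%N.
Proof.
elim: n => [|n IHn]; first by rewrite big_ord0 visits0.
by rewrite big_ord_recr/= visits_step IHn.
Qed.

(** A point never takes a turn of probability 0: here and in the next lemma the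
    prescribed count could not have changed in that direction. *)
Lemma route_parent_gt0 n v : route n (size v).+1 = true :: v -> 0 < p v.
Proof.
move=> [+ pv]; rewrite pv /= => h.
have /andP[p0 _] := p01 v; rewrite lt_neqAle p0 andbT; apply/eqP => p00.
by move: h; rewrite -p00 !mulr0 ltnn.
Qed.

Lemma route_parent_lt1 n v : route n (size v).+1 = false :: v -> p v < 1.
Proof.
move=> [+ pv]; rewrite pv /= => h.
have /andP[_ p1] := p01 v; rewrite lt_neqAle p1 andbT; apply/eqP => p00.
by move: h; rewrite p00 !mulr1 !natrK visits_step pv eqxx addn1 ltnS leqnn.
Qed.

Fixpoint word_mass (w : seq bool) : R :=
  if w is b :: v then word_mass v * (if b then p v else 1 - p v) else 1.

(** Taking an integer part at each of the finitely many nodes above w changes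
    the count by a bounded amount. *)
Lemma cvg_visits w : n%:R^-1 * (visits w n)%:R @[n --> \oo] --> word_mass w.
Proof.
elim: w => [|b v IHv].
  apply: cvg_near_cst; exists 1%N => // n /= n0.
  by rewrite mulVf// pnatr_eq0 -lt0n.
have inv0 := @cvg_natrV R.
have vt : n%:R^-1 * (visits (true :: v) n)%:R @[n --> \oo] --> word_mass (true :: v).
  apply: (squeeze_cvgr (f := fun n => n%:R^-1 * (visits v n)%:R * p v - n%:R^-1)
    (h := fun n => n%:R^-1 * (visits v n)%:R * p v)).
  - apply: nearW => n; rewrite -[n%:R^-1 * _ * _]mulrA -{2}[n%:R^-1]mulr1 -mulrBr.
    rewrite !ler_wpM2l ?invr_ge0//=.
      by rewrite truncn_le mulr_ge0//; have /andP[] := p01 v.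
    by rewrite lerBlDr natr1 ltW// truncnS_gt.
  - rewrite -[X in _ --> X]subr0; apply: cvgB => //.
    by apply: cvgM => //; exact: cvg_cst.
  - by apply: cvgM => //; exact: cvg_cst.
case: b => //=.
rewrite mulrBr mulr1.
rewrite (_ : (fun n => _) = (fun n => n%:R^-1 * (visits v n)%:R -
    n%:R^-1 * (visits (true :: v) n)%:R)).
  exact: cvgB.
apply/funext => n /=; rewrite -mulrBr natrB//.
by have [] := truncn_step (visits v n) (p01 v).
Qed.

Lemma route_word_mass_gt0 n m : 0 < word_mass (route n m).
Proof.
elim: m => [//|m IHm].
have := @route_parent_gt0 n (route n m); have := @route_parent_lt1 n (route n m).
rewrite size_route [route n m.+1]/=; case: (_ < _)%N => /= h1 h0; rewrite mulr_gt0//.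
  exact: h0.
by rewrite subr_gt0; exact: h1.
Qed.

End rotor_router.

(** * Sequences with prescribed weak limit inside the support *)

Section cells.
Context {T : Type} (E : nat -> set T).

Fixpoint cell (w : seq bool) : set T :=
  if w is b :: v then cell v `&` (if b then E (size v) else ~` E (size v))
  else setT.

Lemma cell_inj x w w' : size w = size w' -> cell w x -> cell w' x -> w = w'.
Proof.
elim: w w' => [[]//|b w IHw [//|b' w']] /= [ss] [cw bx] [cw' b'x].
have e := IHw _ ss cw cw'; congr (_ :: _) => //.
by move: bx b'x; rewrite ss; case: b; case: b'.
Qed.

(** A cell of depth at least k decides membership in each E i with i < k. *)
Lemma cell_homogeneous (J : set nat) k w : (k <= size w)%N ->
  cell w `<=` \bigcup_(i in J `&` `I_k) E i \/ cell w `&` \bigcup_(i in J `&` `I_k) E i = set0.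
Proof.
elim: k w => [|k IHk] w kw.
  by right; rewrite II0 setI0 bigcup_set0 setI0.
have [sub|dis] := IHk _ (ltnW kw).
  left; apply: (subset_trans sub); apply: bigcup_sub => i [Ji ik].
  by apply: bigcup_sup; split => //=; exact: ltnW.
have [Jk|nJk] := pselect (J k); last first.
  right; rewrite -dis; congr (_ `&` _); apply/seteqP; split.
    move=> x [i [Ji /= ik] Ex]; exists i => //; split => //=.
    by move: ik; rewrite ltnS leq_eqVlt => /predU1P[ek|//]; rewrite ek in Ji.
  by move=> x [i [Ji /= ik] Ex]; exists i => //; split => //=; exact: ltnW.
have [sub|dis'] : cell w `<=` E k \/ cell w `&` E k = set0.
  elim: w kw {dis} => [//|b w IHw] /=; rewrite ltnS leq_eqVlt => /predU1P[<-|kw].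
    case: b; first by left; exact: subIsetr.
    by right; rewrite -setIA setICl setI0.
  have [sub|dis] := IHw kw; first by left; apply: subset_trans sub; exact: subIsetl.
  by right; rewrite setIAC dis set0I.
  left; apply: (subset_trans sub); apply: bigcup_sup; split => //=.
right; apply/seteqP; split => // x [wx [i [Ji /= ik] Ex]].
move: ik; rewrite ltnS leq_eqVlt => /predU1P[ek|ik].
  have : (cell w `&` E k) x by split => //; rewrite -ek.
  by rewrite dis'.
have : (cell w `&` \bigcup_(i in J `&` `I_k) E i) x by split => //; exists i.
by rewrite dis.
Qed.

End cells.

Section typical_sequence.
Context {R : realType} {T : ptopologicalType} (P : probability (borel T) R).
Variable E : nat -> set T.
Hypothesis oE : forall i, open (E i).
Hypothesis baseE : forall U x, open U -> U x -> exists i, E i x /\ E i `<=` U.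

Lemma open_union_base (U : set T) : open U -> U = \bigcup_(i in [set i | E i `<=` U]) E i.
Proof.
move=> oU; apply/seteqP; split=> [x Ux|]; last by apply: bigcup_sub.
by have [i [Ex EU]] := baseE oU Ux; exists i.
Qed.

Let S := measure_support P.

(** The complement of the support is the union of the null sets of the base. *)
Lemma support_complement : measurable (~` S : set (borel T)) /\ P (~` S) = 0%E.
Proof.
have SE : ~` S = \bigcup_(i in [set i | P (E i) = 0%E]) E i.
  apply/seteqP; split=> [x /existsNP[U /not_implyP[[oU Ux] PU]]|x [i /= PE Ex] Sx].
    have [i [Ex EU]] := baseE oU Ux; exists i => //=; apply/eqP.
    rewrite eq_le measure_ge0 andbT.
    apply: (@le_trans _ _ (P U)); last by rewrite leNgt; exact/negP.
    by apply: le_measure; rewrite ?inE//; exact: open_borel.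
  by have := Sx (E i) (conj (oE i) Ex); rewrite PE ltxx.
have mE i : measurable (E i : set (borel T)) by exact: open_borel.
have mS : measurable (~` S : set (borel T)) by rewrite SE; exact: bigcup_measurable.
split => //; apply: measure_negligible => //; rewrite SE bigcup_mkcond.
apply: negligible_bigcup => i; case: ifPn => [/set_mem PE|_].
  by apply/negligibleP.
exact: negligible_set0.
Qed.

Lemma meets_support (A : set (borel T)) : measurable A -> 0 < fine (P A) -> A `&` S !=set0.
Proof.
have [mS S0] := support_complement.
move=> mA PA; apply/set0P/eqP => AS; move: PA.
suff -> : P A = 0%E by rewrite ltxx.
apply/eqP; rewrite eq_le measure_ge0 andbT -S0 le_measure ?inE//.
by move=> x Ax Sx; have : (A `&` S) x by []; rewrite AS.
Qed.

Lemma measurable_cell w : measurable (cell E w : set (borel T)).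
Proof.
have mE i : measurable (E i : set (borel T)) by exact: open_borel.
elim: w => [|b w IHw] /=; first exact: measurableT.
by apply: measurableI => //; case: b => //; exact: measurableC.
Qed.

Let mass w : R := fine (P (cell E w)).

Let mass_split w : mass w = mass (true :: w) + mass (false :: w).
Proof.
rewrite /mass -fineD ?fin_num_measure//; last 2 first.
  exact: measurable_cell.
  exact: measurable_cell.
congr fine; rewrite -measureU//; last 3 first.
  exact: measurable_cell.
  exact: measurable_cell.
  by rewrite /= setIACA setICr setI0.
by rewrite /= -setIUr setUCr setIT.
Qed.

Let mass_ge0 w : 0 <= mass w. Proof. by rewrite fine_ge0. Qed.

(** At a null cell the quotient is 0, which is harmless: no point is routed
    there. *)
Let p w : R := mass (true :: w) / mass w.

Let p01 w : 0 <= p w <= 1.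
Proof.
rewrite /p; have := mass_split w; have := mass_ge0 (true :: w); have := mass_ge0 (false :: w).
have := mass_ge0 w; rewrite le_eqVlt => /predU1P[<-|w0] h1 h2 h3.
  by rewrite invr0 mulr0 lexx ler01.
rewrite divr_ge0 ?mass_ge0//= ler_pdivrMr// mul1r; lra.
Qed.

Let word_massE w : word_mass p w = mass w.
Proof.
elim: w => [|b w IHw] /=.
  by rewrite /mass (_ : P _ = 1%E)//; exact: probability_setT.
have ms := mass_split w; have h0 := mass_ge0 (true :: w); have h1 := mass_ge0 (false :: w).
rewrite IHw; have [w0|w0] := eqVneq (mass w) 0.
  by rewrite w0 mul0r; case: b; lra.
have wp : mass w * p w = mass (true :: w) by rewrite mulrC divfK.
by case: b => //; rewrite mulrBr mulr1 wp; lra.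
Qed.

Let route_cell n k m : (k <= m)%N -> cell E (route p n m) `<=` cell E (route p n k).
Proof.
elim: m => [|m IHm]; first by rewrite leqn0 => /eqP ->.
rewrite leq_eqVlt => /predU1P[->//|km] x /= [+ _]; exact: IHm.
Qed.

Section frequencies.
Variable z : nat -> T.
Hypothesis zcell : forall n, cell E (route p n n) (z n).

(** As soon as i is at least the depth of w, the point z i lies in the cell of w
    exactly when the i-th route passes through w; the earlier points contribute
    a bounded error. *)
Let cvg_cell w : average z n (\1_(cell E w)) @[n --> \oo] --> mass w.
Proof.
pose k := size w.
pose d i : R := \1_(cell E w) (z i) - (route p i k == w)%:R.
have d_le i : `|d i| <= (i < k)%:R.
  rewrite /d indicE; have [ik|ki] := ltnP i k.
    by case: (_ \in _); case: (_ == _);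
      rewrite ?subrr ?normr0 ?subr0 ?sub0r ?normrN ?normr1.
  have zk : cell E (route p i k) (z i) by apply: route_cell (zcell i).
  suff -> : (z i \in cell E w) = (route p i k == w) by rewrite subrr normr0.
  apply/idP/eqP => [/set_mem zw|<-]; last exact/mem_set.
  by apply: cell_inj zk zw; rewrite size_route.
have sum_lt n : (\sum_(i < n) (i < k) <= k)%N.
  have -> : (\sum_(i < n) (i < k) = minn n k)%N; last exact: geq_minr.
  elim: n => [|n IHn]; first by rewrite big_ord0 min0n.
  by rewrite big_ord_recr/= IHn; case: ltnP; lia.
have D_le n : `|\sum_(i < n) d i| <= k%:R.
  apply: (le_trans (ler_norm_sum _ _ _)).
  apply: (@le_trans _ _ (\sum_(i < n) (i < k)%:R)); first exact: ler_sum.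
  by rewrite -natr_sum ler_nat.
have -> : (fun n => average z n (\1_(cell E w))) =
          (fun n => n%:R^-1 * (visits p w n)%:R + n%:R^-1 * \sum_(i < n) d i).
  apply/funext => n; rewrite -mulrDr; congr (_ * _).
  rewrite (visits_sum p01) natr_sum -big_split/=.
  by apply: eq_bigr => i _; rewrite /d addrC subrK.
rewrite -[mass w]addr0 -word_massE; apply: cvgD; first exact: cvg_visits.
have kV : n%:R^-1 * k%:R @[n --> \oo] --> (0 : R).
  by rewrite -(mul0r k%:R); apply: cvgM; [exact: cvg_natrV|exact: cvg_cst].
apply: (squeeze_cvgr (f := fun n => - (n%:R^-1 * k%:R)) (h := fun n => n%:R^-1 * k%:R)) => //.
  apply: nearW => n; rewrite -ler_norml normrM ger0_norm ?invr_ge0//.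
  by rewrite ler_wpM2l ?invr_ge0.
by rewrite -oppr0; exact: cvgN.
Qed.

(** Downward induction on the depth of w: a cell is split into its two children
    until it is homogeneous with respect to V. *)
Let cvg_union_in_cell (J : set nat) N k w :
  let V := \bigcup_(i in J `&` `I_N) E i in (size w + k = N)%N ->
  average z n (\1_(cell E w `&` V)) @[n --> \oo] --> fine (P (cell E w `&` V)).
Proof.
move=> V; have mV : measurable (V : set (borel T)).
  by apply: bigcup_measurable => i _; exact: open_borel.
elim: k w => [|k IHk] w.
  rewrite addn0 => sw; have [sub|->] := cell_homogeneous E J (eq_leq (esym sw)).
    by rewrite setIidl//; exact: cvg_cell.
  rewrite measure0; apply: cvg_near_cst; apply: nearW => n.
  by rewrite /average big1 ?mulr0// => i _; rewrite indic0.
rewrite addnS -addSn => sw.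
have split_cell : cell E w `&` V = (cell E (true :: w) `&` V) `|` (cell E (false :: w) `&` V).
  by rewrite -setIUl /= -setIUr setUCr setIT.
have disj : (cell E (true :: w) `&` V) `&` (cell E (false :: w) `&` V) = set0.
  by apply/seteqP; split => // x /= [[[_ Ex] _] [[_ nEx] _]]; exact: nEx.
rewrite split_cell measureU//; last 2 first.
  by apply: measurableI => //; exact: measurable_cell.
  by apply: measurableI => //; exact: measurable_cell.
rewrite fineD ?fin_num_measure//; last 2 first.
  by apply: measurableI => //; exact: measurable_cell.
  by apply: measurableI => //; exact: measurable_cell.
rewrite (_ : (fun n => _) = (fun n => average z n (\1_(cell E (true :: w) `&` V)) +
    average z n (\1_(cell E (false :: w) `&` V)))).
  by apply: cvgD; exact: IHk.
apply/funext => n; rewrite -mulrDr -big_split/=; congr (_ * _); apply: eq_bigr => i _.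
rewrite !indicE in_setU; case: (boolP (z i \in _)) => [/set_mem zt|_]; last first.
  by rewrite add0r.
rewrite memNset ?addr0// => zf.
have : ((cell E (true :: w) `&` V) `&` (cell E (false :: w) `&` V)) (z i) by [].
by rewrite disj.
Qed.

(** An open set is the increasing union of the finite unions of base sets that it
    contains, and the frequencies of the latter converge. *)
Lemma liminf_open_frequency (U : set T) (e : R) : open U -> 0 < e ->
  \forall n \near \oo, fine (P U) - e <= average z n (\1_U).
Proof.
move=> oU e0; pose J := [set i | E i `<=` U].
pose V N : set (borel T) := \bigcup_(i in J `&` `I_N) E i.
have mV N : measurable (V N) by apply: bigcup_measurable => i _; exact: open_borel.
have VU N : V N `<=` U by apply: bigcup_sub => i [].
have UV : \bigcup_N V N = U.
  apply/seteqP; split=> [x [N _ /VU//]|x].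
  rewrite {1}(open_union_base oU) => -[i Ji Ex]; exists i.+1 => //.
  by exists i => //; split => //=.
have ndV : nondecreasing_seq V.
  move=> M N MN; apply/subsetPset => x [i [Ji /= iM] Ex]; exists i => //; split => //=.
  exact: leq_trans MN.
have e2 : 0 < e / 2 by rewrite divr_gt0.
have [N PN] : exists N, fine (P U) - e / 2 < fine (P (V N)).
  apply: contrapT => /forallNP nP.
  have := @nondecreasing_cvg_mu _ _ _ P V mV _ ndV.
  rewrite UV => /(_ (open_borel oU)) PV.
  have : (P U <= (fine (P U) - e / 2)%:E)%E.
    apply: (cvge_to_le PV); apply: nearW => N /=.
    rewrite -[leLHS]fineK ?fin_num_measure// lee_fin leNgt; exact/negP.
  rewrite -[leLHS]fineK ?fin_num_measure//; last exact: open_borel.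
  by rewrite lee_fin; lra.
have := @cvg_union_in_cell J N N [::] (add0n N).
rewrite /= setTI => VN.
have eN : fine (P U) - e < fine (P (V N)) by apply: lt_trans PN; lra.
apply: filterS (cvgr_ge _ VN _ eN) => n /le_trans; apply; rewrite ler_wpM2l ?invr_ge0//.
apply: ler_sum => i _; rewrite !indicE.
by have [/set_mem/VU/mem_set ->|_] := boolP (z i \in V N).
Qed.

End frequencies.

(** The n-th point is any point of the support in the cell of the first n turns
    of the n-th route; this cell has positive mass, so it meets the support. *)
Lemma typical_sequence :
  exists z, (forall n, S (z n)) /\ weakly_converges (empirical z) P.
Proof.
have /choice[z zP] : forall n, exists x, (cell E (route p n n) `&` S) x.
  move=> n; apply: meets_support; first exact: measurable_cell.
  by rewrite -/(mass _) -word_massE route_word_mass_gt0.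
exists z; split; first by move=> n; have [] := zP n.
apply: portmanteau => U e oU e0; apply: liminf_open_frequency => // n.
by have [] := zP n.
Qed.

End typical_sequence.

Lemma cozero_base_typical_sequence {R : realType} (T : ptopologicalType)
    (g : nat -> T -> R) (P : probability (borel T) R) : cozero_base g ->
  exists z, (forall n, measure_support P (z n)) /\ weakly_converges (empirical z) P.
Proof.
move=> [cg g0 gU]; apply: (@typical_sequence _ _ P (fun i => [set x | 0 < g i x])).
  by move=> i; exact: open_cozero.
by move=> U x oU Ux; have [i] := gU U x oU Ux; exists i.
Qed.

(** * Couplings versus sequences *)

Section support_product.
Context {R : realType} {T : ptopologicalType} (P : probability (borel T) R).
Let PP : set (T * T) -> \bar R := (P \x P)%E.

Lemma support_product_fst p q : measure_support PP (p, q) -> measure_support P p.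
Proof.
move=> pq U [oU Up].
have oV : open (U `*` setT : set (T * T)).
  rewrite (_ : _ `*` _ = fst @^-1` U); first by apply: open_comp => // x _; exact: cvg_fst.
  by apply/seteqP; split => [x []|x].
have := pq _ (conj oV (conj Up Logic.I)); rewrite /PP product_measure1E//.
- by rewrite [X in (_ * X)%E](_ : _ = 1%E) ?mule1//; exact: probability_setT.
- exact: open_borel.
Qed.

Lemma support_product_snd p q : measure_support PP (p, q) -> measure_support P q.
Proof.
move=> pq U [oU Up].
have oV : open (setT `*` U : set (T * T)).
  rewrite (_ : _ `*` _ = snd @^-1` U); first by apply: open_comp => // x _; exact: cvg_snd.
  by apply/seteqP; split => [x []|x].
have := pq _ (conj oV (conj Logic.I Up)); rewrite /PP product_measure1E//.
- by rewrite [X in (X * _)%E](_ : _ = 1%E) ?mul1e//; exact: probability_setT.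
- exact: open_borel.
Qed.

(** An open set of the product is a countable union of rectangles of base sets,
    so it belongs to the product sigma-algebra. *)
Lemma open_product_measurable (E : nat -> set T) (U : set (T * T)) :
  (forall i, open (E i)) ->
  (forall U x, open U -> U x -> exists i, E i x /\ E i `<=` U) ->
  open U -> measurable (U : set (borel T * borel T)%type).
Proof.
move=> oE baseE oU.
have -> : U = \bigcup_i \bigcup_(j in [set j | E i `*` E j `<=` U]) (E i `*` E j).
  apply/seteqP; split=> [[x y] Uxy|x [i _ [j ijU ijx]]]; last exact: ijU.
  have [[A B] /= [xA yB] ABU] : nbhs (x, y) U by exact: open_nbhs_nbhs.
  have [i [xi iA]] := baseE A° x (open_interior _) xA.
  have [j [yj jB]] := baseE B° y (open_interior _) yB.
  exists i => //; exists j => //= -[x' y'] [/= xi' yj']; apply: ABU; split => /=.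
    exact: interior_subset (iA _ xi').
  exact: interior_subset (jB _ yj').
apply: bigcup_measurable => i _; apply: bigcup_measurable => j _.
by apply: measurableX; exact: open_borel.
Qed.

Lemma support_product (g : nat -> T -> R) p q : cozero_base g ->
  measure_support P p -> measure_support P q -> measure_support PP (p, q).
Proof.
move=> [cg g0 gU] Sp Sq U [oU Upq].
have mU : measurable (U : set (borel T * borel T)%type).
  have og i : open [set x | 0 < g i x] by exact: open_cozero.
  exact: (open_product_measurable og).
have [[A B] /= [pA qB] ABU] : nbhs (p, q) U by exact: open_nbhs_nbhs.
have mA : measurable (A° : set (borel T)) by apply: open_borel; exact: open_interior.
have mB : measurable (B° : set (borel T)) by apply: open_borel; exact: open_interior.
apply: (@lt_le_trans _ _ (PP (A° `*` B°))).
  rewrite /PP product_measure1E// mule_gt0//.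
    by apply: Sp; split => //; exact: open_interior.
  by apply: Sq; split => //; exact: open_interior.
apply: le_measure; rewrite ?inE//; first exact: measurableX.
by move=> [x y] [/= Ax By]; apply: ABU; split => /=; exact: interior_subset.
Qed.

End support_product.

Section costs.
Context {R : realType} {B : polishMetricType R} (X Y : mmField B).

Lemma sup_le {I : Type} (A : set I) (f : I -> R) (d : R) :
  (ereal_sup [set (f i)%:E | i in A] <= d%:E)%E <-> forall i, A i -> f i <= d.
Proof.
split=> [fd i Ai|fd].
  by rewrite -lee_fin (le_trans _ fd)//; apply: ereal_sup_ubound; exists i.
by apply: ge_ereal_sup => _ [i Ai <-]; rewrite lee_fin fd.
Qed.

Lemma half_sup_le {I : Type} (A : set I) (f : I -> R) (d : R) :
  ((2^-1)%:E * ereal_sup [set (f i)%:E | i in A] <= d%:E)%E <->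
  forall i, A i -> f i <= 2 * d.
Proof.
by rewrite lee_pdivrMl// -EFinM; exact: sup_le.
Qed.

Lemma sequence_cost_le (x : nat -> X) (y : nat -> Y) (d : R) :
  (sequence_cost x y <= d%:E)%E ->
  (forall i j, distortion (x i, y i) (x j, y j) <= 2 * d) /\
  (forall i, fiber_dist (x i, y i) <= d).
Proof.
rewrite /sequence_cost ge_max => /andP[/half_sup_le dist /sup_le fib]; split.
  by move=> i j; exact: (dist (i, j)).
by move=> i; exact: fib.
Qed.

Lemma sequence_cost_ge0 (x : nat -> X) (y : nat -> Y) : (0 <= sequence_cost x y)%E.
Proof.
rewrite /sequence_cost le_max; apply/orP; right.
apply: (@le_trans _ _ (fiber_dist (x 0%N, y 0%N))%:E).
  by rewrite lee_fin mdist_ge0.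
by apply: ereal_sup_ubound; exists 0%N.
Qed.

Lemma distortion_perturb (p q p' q' : X * Y) :
  distortion p q <= distortion p' q' +
    (mdist p.1 p'.1 + mdist q.1 q'.1 + (mdist p.2 p'.2 + mdist q.2 q'.2)).
Proof.
have quad (Z : polishMetricType R) (a b a' b' : Z) :
    `|mdist a b - mdist a' b'| <= mdist a a' + mdist b b'.
  rewrite ler_norml; apply/andP; split.
    have := metric_triangle a' a b'; have := metric_triangle a b b'.
    rewrite (metric_sym a' a); lra.
  have := metric_triangle a a' b; have := metric_triangle a' b' b.
  rewrite (metric_sym b' b); lra.
rewrite /distortion.
have h1 := quad X p.1 q.1 p'.1 q'.1; have h2 := quad Y p.2 q.2 p'.2 q'.2.
have -> : mdist p.1 q.1 - mdist p.2 q.2 = (mdist p'.1 q'.1 - mdist p'.2 q'.2) +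
  ((mdist p.1 q.1 - mdist p'.1 q'.1) - (mdist p.2 q.2 - mdist p'.2 q'.2)) by lra.
rewrite (le_trans (ler_normD _ _))// lerD2l (le_trans (ler_normB _ _))//.
exact: lerD.
Qed.

Lemma fiber_dist_perturb (p p' : X * Y) :
  fiber_dist p <= fiber_dist p' + (mdist p.1 p'.1 + mdist p.2 p'.2).
Proof.
rewrite /fiber_dist.
have h1 := mm_proj_lipschitz p.1 p'.1; have h2 := mm_proj_lipschitz p.2 p'.2.
have := metric_triangle (mm_proj p.1) (mm_proj p'.1) (mm_proj p.2).
have := metric_triangle (mm_proj p'.1) (mm_proj p'.2) (mm_proj p.2).
rewrite (metric_sym (mm_proj p'.2)); lra.
Qed.

(** Sequences of typical points in the support of m only see distances that
    enter the suprema defining the cost of m. *)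
Lemma coupling_to_sequences (m : probability (borel (X * Y)%type) R) :
  couplings X Y m -> exists x y, [/\ uniformly_distributed X x,
    uniformly_distributed Y y & (sequence_cost x y <= coupling_cost m)%E].
Proof.
move=> [mX mY].
have [gX bX] := polish_cozero_base X; have [gY bY] := polish_cozero_base Y.
have [g bg] := prod_cozero_base bX bY.
have [z [Sz /weakly_convergesE uz]] := cozero_base_typical_sequence m bg.
have cfst : continuous (fst : X * Y -> X) by move=> x; exact: cvg_fst.
have csnd : continuous (snd : X * Y -> Y) by move=> x; exact: cvg_snd.
have marginal (Z : ptopologicalType) (h : X * Y -> Z) (P : probability (borel Z) R)
    (f : Z -> R) : continuous h ->
    (forall A : set (borel Z), measurable A -> m (h @^-1` A) = P A) ->
    continuous f -> bounded_fun f -> \int[m]_p (f (h p)) = \int[P]_x f x.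
  move=> ch hP cf bf; congr fine.
  have mh := continuous_borel_measurable_map ch.
  rewrite -(@integral_pushforward _ _ (borel (X * Y)%type) (borel Z) R h mh m setT (EFin \o f)) //.
  - apply: eq_measure_integral => A mA _; exact: hP.
  - apply/measurable_EFinP; exact: continuous_borel_measurable.
  - rewrite preimage_setT; apply: (@probability_integrable _ _ m (f \o h)).
      by move=> p; apply: continuous_comp; [exact: ch|exact: cf].
    exact: bounded_fun_comp.
exists (fst \o z), (snd \o z); split.
- apply/weakly_convergesE => f cf bf; rewrite -(marginal _ fst)//.
  apply: (uz (f \o fst)); last exact: bounded_fun_comp.
  by move=> p; apply: continuous_comp; [exact: cfst|exact: cf].
- apply/weakly_convergesE => f cf bf; rewrite -(marginal _ snd)//.
  apply: (uz (f \o snd)); last exact: bounded_fun_comp.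
  by move=> p; apply: continuous_comp; [exact: csnd|exact: cf].
- rewrite /sequence_cost /coupling_cost ge_max; apply/andP; split.
    rewrite le_max; apply/orP; left; apply: lee_wpmul2l => //.
    apply: le_ereal_sup => _ [[i j] _ <-]; exists (z i, z j).
      by apply: (support_product bg).
    by rewrite /distortion.
  rewrite le_max; apply/orP; right.
  by apply: le_ereal_sup => _ [i _ <-]; exists (z i).
Qed.

(** A point of the support of the limit coupling is approached by pairs of
    matched points of the k-th sequences for a set of indices k in the
    ultrafilter. Two points of the support can thus be approached with the same
    large k, and the cost of the k-th sequences is close to c. *)
Lemma sequences_to_coupling (x : nat -> nat -> X) (y : nat -> nat -> Y) (c : R) :
  (forall k, uniformly_distributed X (x k)) ->
  (forall k, uniformly_distributed Y (y k)) ->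
  (forall k, sequence_cost (x k) (y k) <= (c + k.+1%:R^-1)%:E)%E ->
  exists2 m, couplings X Y m & (coupling_cost m <= c%:E)%E.
Proof.
move=> ux uy xy; have [m [U [Cm PU ooU mU]]] := coupling_of_sequences ux uy.
exists m => //.
have near_supp p e : measure_support (T := (X * Y)%type) m p -> 0 < e ->
    U [set k | exists i, mdist p.1 (x k i) < e /\ mdist p.2 (y k i) < e].
  move=> Sp e0; pose g (q : X * Y) := Num.min (tent p.1 e q.1) (tent p.2 e q.2).
  have cg : continuous g.
    move=> q; apply: (@continuous_min _ _ (tent p.1 e \o fst) (tent p.2 e \o snd)).
      by apply: continuous_comp; [exact: cvg_fst|exact: continuous_tent].
    by apply: continuous_comp; [exact: cvg_snd|exact: continuous_tent].
  have g0 q : 0 <= g q by rewrite le_min !tent_ge0.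
  have og : open [set q | 0 < g q] by exact: open_cozero.
  have gp : 0 < g p by rewrite lt_min !tent_gt0 !mdistxx e0.
  apply: filterS (mU g cg g0 (Sp _ (conj og gp))) => k [i].
  by rewrite lt_min !tent_gt0 => /andP[]; exists i.
have near_k (e : R) : 0 < e -> U [set k | k.+1%:R^-1 < e].
  move=> e0; apply: ooU; have [//|k0] := @ltr_add_invr R 0 e; rewrite add0r => k0e.
  exists k0 => // k /= k0k; apply: le_lt_trans k0e.
  by rewrite lef_pV2 ?posrE// ler_nat ltnS.
rewrite /coupling_cost ge_max; apply/andP; split.
  apply/half_sup_le => -[p q] /= Spq.
  have Sp := support_product_fst Spq; have Sq := support_product_snd Spq.
  (* Four distances less than e, and twice the excess over c, also less than e. *)
  apply/ler_addgt0Pr => d d0; pose e := d / 6; have e0 : 0 < e by rewrite divr_gt0.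
  have [k [[[i [pi1 pi2]] [j [qj1 qj2]]] ke]] :=
    filter_ex (filterI (filterI (near_supp _ _ Sp e0) (near_supp _ _ Sq e0)) (near_k _ e0)).
  have [/(_ i j) dij _] := sequence_cost_le (xy k).
  have := distortion_perturb p q (x k i, y k i) (x k j, y k j).
  rewrite /= => pert; have de : d = 6 * e by rewrite mulrC divfK.
  move: ke dij => /=; set t := k.+1%:R^-1 => ke dij; clearbody e t; lra.
apply/sup_le => p Sp.
(* Two distances less than e, and an excess over c less than e. *)
apply/ler_addgt0Pr => d d0; pose e := d / 3; have e0 : 0 < e by rewrite divr_gt0.
have [k [[i [pi1 pi2]] ke]] := filter_ex (filterI (near_supp _ _ Sp e0) (near_k _ e0)).
have [_ /(_ i) fi] := sequence_cost_le (xy k).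
have := fiber_dist_perturb p (x k i, y k i).
rewrite /= => pert; have de : d = 3 * e by rewrite mulrC divfK.
move: ke fi => /=; set t := k.+1%:R^-1 => ke fi; clearbody e t; lra.
Qed.

End costs.

Local Open Scope ereal_scope.

Theorem theorem5p5 (R : realType) (B : polishMetricType R) (X Y : mmField B)
    (boundedX : diameter X < +oo) (boundedY : diameter Y < +oo) :
  let costs := [set sequence_cost x y
                  | x in uniformly_distributed X & y in uniformly_distributed Y] in
  dGWoo X Y = ereal_inf costs /\
  exists x y, [/\ uniformly_distributed X x, uniformly_distributed Y y &
                  sequence_cost x y = ereal_inf costs].
Proof.
move=> costs.
have inf_le x y : uniformly_distributed X x -> uniformly_distributed Y y ->
    ereal_inf costs <= sequence_cost x y.
  by move=> ux uy; apply: ereal_inf_lbound; exists x => //; exists y.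
have inf_le_dGW : ereal_inf costs <= dGWoo X Y.
  apply: le_ereal_inf_tmp => _ [m Cm <-].
  have [x [y [ux uy xym]]] := coupling_to_sequences Cm.
  exact: le_trans (inf_le _ _ ux uy) xym.
have inf_ge0 : 0 <= ereal_inf costs.
  by apply: le_ereal_inf_tmp => _ [x _ [y _ <-]]; exact: sequence_cost_ge0.
(* If the infimum is infinite, any uniformly distributed sequences realize it. *)
have [infoo|inf_fin] := eqVneq (ereal_inf costs) +oo.
  split; first by apply/eqP; rewrite eq_le inf_le_dGW infoo leey.
  have [gX bX] := polish_cozero_base X; have [gY bY] := polish_cozero_base Y.
  have [x [_ ux]] := cozero_base_typical_sequence (mm_law X) bX.
  have [y [_ uy]] := cozero_base_typical_sequence (mm_law Y) bY.
  exists x, y; split => //; apply/eqP.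
  by rewrite eq_le inf_le// andbT infoo leey.
have {}inf_fin : ereal_inf costs \is a fin_num by rewrite ge0_fin_numE// ltey.
have /choice[xy xyP] : forall k, exists xy : (nat -> X) * (nat -> Y),
    [/\ uniformly_distributed X xy.1, uniformly_distributed Y xy.2 &
        sequence_cost xy.1 xy.2 <= (fine (ereal_inf costs) + k.+1%:R^-1)%:E].
  move=> k; have k0 : (0 < k.+1%:R^-1 :> R)%R by rewrite invr_gt0.
  have [_ [x ux [y uy <-]] /ltW xyk] := lb_ereal_inf_adherent k0 inf_fin.
  by exists (x, y); split => //; rewrite EFinD fineK.
have [m Cm mc] : exists2 m, couplings X Y m & coupling_cost m <= (fine (ereal_inf costs))%:E.
  by apply: (sequences_to_coupling (x := fun k => (xy k).1) (y := fun k => (xy k).2)) => k;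
    have [] := xyP k.
rewrite fineK// in mc.
split.
  apply/eqP; rewrite eq_le inf_le_dGW andbT (le_trans _ mc)//.
  by apply: ereal_inf_lbound; exists m.
have [x [y [ux uy xym]]] := coupling_to_sequences Cm.
exists x, y; split => //; apply/eqP; rewrite eq_le inf_le// andbT.
exact: le_trans mc.
Qed.
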